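(* There exists an online decide-on-arrival scheduler for the serial-parallel scheduling problem that is $3$-competitive for awake time: for every task arrival process $\mathcal{T}$, the awake time of the scheduler on $\mathcal{T}$ is at most $3$ times the awake time of the optimal offline schedule $\texttt{OPT}$ on $\mathcal{T}$.
   Context: Serial-parallel scheduling problem: there are $p$ identical processors ($p$ at least a sufficiently large constant). A task arrival process (TAP) is a finite set of tasks $\tau_1,\dots,\tau_n$; task $\tau_i$ is a triple $(\sigma_i,\pi_i,t_i)$ with arrival time $t_i\ge 0$ ($t_1\le\dots\le t_n$), serial work $\sigma_i$ and parallel work $\pi_i$, where $1\le \pi_i/\sigma_i\le p$. Each task can be performed either by its serial job (work $\sigma_i$, may run on at most one processor at any instant) or by its parallel job (work $\pi_i$, may run on any number of processors simultaneously, progressing at a rate equal to the number of processors). Time is continuous; at each instant the scheduler allocates the $p$ processors (fractionally, via time sharing) among arrived, unfinished jobs; a job completes when the integral over time of the processors allocated to it reaches its work. Before any work is done on a task the scheduler must irrevocably choose which of its two jobs to run; preemption (pausing and later resuming, possibly on other processors) is allowed. A task is alive from its arrival until its completion. The awake time of a schedule is the total measure of the set of times at which at least one task is alive. An online scheduler learns about task $\tau_i$ (its $\sigma_i,\pi_i,t_i$) only at time $t_i$ and does not know $n$ in advance; $\texttt{OPT}$ denotes an optimal offline schedule that knows the whole TAP in advance. A decide-on-arrival scheduler must, at the moment each task arrives, immediately and irrevocably decide whether to run its serial or parallel job. *)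

(* Defs.v *)
From HB Require Import structures.
From mathcomp Require Import all_boot all_order all_algebra.
From mathcomp Require Import all_classical all_reals all_analysis.
Set Implicit Arguments. Unset Strict Implicit. Unset Printing Implicit Defensive.
Import Order.TTheory GRing.Theory Num.Theory.
Local Open Scope classical_set_scope.
Local Open Scope ring_scope.

Section SerialParallel.
Variable R : realType.

(* A task (sigma_i, pi_i, t_i): serial work, parallel work, arrival time. *)
Record task := Task { sig : R; par : R; arr : R }.

Definition task0 : task := Task 0 0 0.

(* A task arrival process: a finite list of tasks tau_1 .. tau_n (index i-1). *)
Definition TAP := seq task.

Definition tsk (T : TAP) (i : nat) : task := nth task0 T i.

Definition valid_task (p : nat) (x : task) : Prop :=
  0 <= arr x /\ 0 < sig x /\ 1 <= par x / sig x /\ par x / sig x <= p%:R.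

Definition valid_TAP (p : nat) (T : TAP) : Prop :=
  (forall i, (i < size T)%N -> valid_task p (tsk T i)) /\
  sorted (fun x y : task => arr x <= arr y) T.

(* A schedule: for each task index i, the irrevocable choice (true = parallel
   job, false = serial job), the (fractional) processor allocation to it at
   each instant, and its completion time. *)
Record schedule := Schedule {
  choice : nat -> bool;
  alloc  : nat -> R -> R;
  compl  : nat -> R }.

Definition work (T : TAP) (S : schedule) (i : nat) : R :=
  if choice S i then par (tsk T i) else sig (tsk T i).

Definition feasible (p : nat) (T : TAP) (S : schedule) : Prop :=
  (forall t : R, \sum_(i < size T) alloc S i t <= p%:R) /\
  forall i, (i < size T)%N ->
    measurable_fun setT (alloc S i) /\
    arr (tsk T i) <= compl S i /\
    (forall t, 0 <= alloc S i t) /\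
    (forall t, t < arr (tsk T i) \/ compl S i < t -> alloc S i t = 0) /\
    (choice S i = false -> forall t, alloc S i t <= 1) /\
    (\int[@lebesgue_measure R]_(x in `[arr (tsk T i), compl S i])
        (alloc S i x)%:E = (work T S i)%:E)%E /\
    (forall t, t < compl S i ->
      (\int[@lebesgue_measure R]_(x in `[arr (tsk T i), t])
          (alloc S i x)%:E < (work T S i)%:E)%E).

Definition awake (T : TAP) (S : schedule) : \bar R :=
  @lebesgue_measure R
    [set x | exists2 i, (i < size T)%N & arr (tsk T i) <= x < compl S i].

Definition scheduler := TAP -> schedule.

Definition prefix (t : R) (T : TAP) : TAP := seq.filter (fun x => arr x <= t) T.

Definition online (p : nat) (A : scheduler) : Prop :=
  forall T T' (t : R), valid_TAP p T -> valid_TAP p T' ->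
    prefix t T = prefix t T' ->
    forall i, (i < size (prefix t T))%N -> alloc (A T) i t = alloc (A T') i t.

Definition decide_on_arrival (p : nat) (A : scheduler) : Prop :=
  forall T T' i, valid_TAP p T -> valid_TAP p T' -> (i < size T)%N ->
    prefix (arr (tsk T i)) T = prefix (arr (tsk T i)) T' ->
    choice (A T) i = choice (A T') i.

End SerialParallel.

(* Main.v *)
(* On its arrival, task i is run in parallel iff some offline schedule of the
   tasks 0 .. i would be awake, after that arrival, for less than half of the
   serial work of i.  Serial jobs have priority, in FIFO order and without
   preemption; parallel jobs share what is left, also in FIFO order.

   Fix an offline schedule; Z(s) and Y(s) are its awake times after and before
   s, E(s) is the awake time of our scheduler before s.  By the rule, a task run
   serially has serial work at most 2 Z(a_i).  The parallel work arriving from s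
   on is at most 2 p Z(s): if j is the last task run in parallel by us but
   serially by the schedule, then Z(a_j) >= sigma_j is at least twice the awake
   time after a_j of the schedule that witnesses the rule for j; the later tasks
   are charged to p Z(a_j), and those up to j, inductively, to a hybrid of the
   two schedules.

   Then E(t) <= 3 Y(t) whenever the offline schedule is idle at t.  The key is
   E(r) + Q(r)/p <= 2 Y(r) + Y(t) at each arrival r before t, with Q(r) the serial
   work left at r, arrivals up to t included.  Going back from r to the last
   moment v where the schedule is idle and fewer than p serial jobs are alive,
   the left-hand side grows only while the schedule is awake, and at v it is
   bounded by the induction hypothesis. *)
Require Import Defs.
From HB Require Import structures.
From mathcomp Require Import all_boot all_order all_algebra.
From mathcomp Require Import all_classical all_reals all_analysis.
From mathcomp Require Import measurable_realfun lra zify.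
Set Implicit Arguments. Unset Strict Implicit. Unset Printing Implicit Defensive.
Import Order.TTheory GRing.Theory Num.Theory.
Local Open Scope ring_scope.

(** * Lengths of finite unions of intervals *)

Section Length.
Local Open Scope classical_set_scope.
Local Open Scope ring_scope.
Variable R : realType.
Implicit Types (X Y Z : set R) (s t u v : R) (a d : nat -> R) (K : pred nat).

Notation mu := (@lebesgue_measure R).

(** A real-valued measure, convenient for linear arithmetic. As [fine] sends an infinite value to 0,
    it is used on sets that are [small]. *)
Definition len X : R := fine (mu X).

Definition small X : Prop := measurable X /\ (mu X < +oo)%E.

Lemma small_len X : small X -> mu X = (len X)%:E.
Proof. by move=> [_ h]; rewrite /len fineK// ge0_fin_numE. Qed.

Lemma len_ge0 X : 0 <= len X.
Proof. exact/fine_ge0. Qed.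

Lemma small_sub X Y : measurable X -> X `<=` Y -> small Y -> small X.
Proof.
move=> mX XY [mY hY]; split => //; apply: le_lt_trans hY.
by apply: le_measure; rewrite ?inE.
Qed.

Lemma smallI X Y : small X -> measurable Y -> small (X `&` Y).
Proof.
move=> sX mY; apply: (small_sub _ _ sX) => [|x []//].
by apply: measurableI => //; case: sX.
Qed.

Lemma smallU X Y : small X -> small Y -> small (X `|` Y).
Proof.
move=> [mX hX] [mY hY]; split; first exact: measurableU.
by rewrite (le_lt_trans (measureU2 mu mX mY))// lte_add_pinfty.
Qed.

Lemma small0 : small set0.
Proof. by split; rewrite ?measure0. Qed.

Lemma small_itv s t : small `[s, t[.
Proof.
split; first exact: measurable_itv.
by rewrite lebesgue_measure_itv/= lte_fin; case: ifP => // _; rewrite -EFinB ltry.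
Qed.

Lemma len_le X Y : small X -> small Y -> X `<=` Y -> len X <= len Y.
Proof.
move=> sX sY XY; rewrite -lee_fin -!small_len//.
by case: sX => mX _; case: sY => mY _; apply: le_measure; rewrite ?inE.
Qed.

Lemma len_leU X Y Z : small X -> small Y -> small Z ->
  X `<=` Y `|` Z -> len X <= len Y + len Z.
Proof.
move=> sX sY sZ XYZ; apply: (le_trans (len_le sX (smallU sY sZ) XYZ)).
rewrite -lee_fin EFinD -!small_len//; last exact: smallU.
by apply: measureU2; [case: sY|case: sZ].
Qed.

Lemma lenU X Y : small X -> small Y -> X `&` Y = set0 ->
  len (X `|` Y) = len X + len Y.
Proof.
move=> sX sY XY0; apply: EFin_inj; rewrite EFinD -!small_len//; last exact: smallU.
by rewrite measureU//; [case: sX|case: sY].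
Qed.

Lemma len_itv s t : s <= t -> len `[s, t[ = t - s.
Proof.
move=> st; rewrite /len lebesgue_measure_itv/= lte_fin.
by case: ltP => [_|ts]; rewrite ?fine0//=; lra.
Qed.

Lemma small_itvoo s t : small `]s, t[.
Proof.
by apply: small_sub (small_itv s t) => // x; rewrite /= !in_itv/= => /andP[/ltW -> ->].
Qed.

Lemma len_itvoo s t : s <= t -> len `]s, t[ = t - s.
Proof.
move=> st; rewrite /len lebesgue_measure_itv/= lte_fin.
by case: ltP => [_|ts]; rewrite ?fine0//=; lra.
Qed.

Definition before X t : R := len (X `&` `]-oo, t[).

Lemma before_ge0 X t : 0 <= before X t.
Proof. exact: len_ge0. Qed.

Lemma before_seg X s t : small X -> s <= t ->
  before X t = before X s + len (X `&` `[s, t[).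
Proof.
move=> sX st; rewrite /before -lenU.
- congr len; apply/seteqP; split => [x [Xx]|x [[Xx]|[Xx]]]; rewrite /= !in_itv/=.
  + by case: (ltP x s) => ?; [left|right] => //; split => //=; rewrite in_itv/= ?andbT//; apply/andP.
  + by move=> xs; split=> //; apply: lt_le_trans st.
  + by case/andP.
- by apply: smallI.
- by apply: smallI.
- apply/seteqP; split => // x [[_]] /=; rewrite !in_itv/= => xs [_].
  by rewrite leNgt xs.
Qed.

Lemma before_le X s t : small X -> s <= t -> before X s <= before X t.
Proof. by move=> sX st; rewrite (before_seg sX st) lerDl len_ge0. Qed.

Lemma before_lip X s t : small X -> s <= t -> before X t <= before X s + (t - s).
Proof.
move=> sX st; rewrite (before_seg sX st) lerD2l -len_itv//.
by apply: len_le => [||x []//]; [exact: smallI|exact: small_itv].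
Qed.

Definition after X s : R := len (X `&` `[s, +oo[).

Lemma after_ge0 X s : 0 <= after X s.
Proof. exact: len_ge0. Qed.

Lemma after_seg X s t : small X -> s <= t ->
  after X s = len (X `&` `[s, t[) + after X t.
Proof.
move=> sX st; rewrite /after -lenU.
- congr len; apply/seteqP; split => [x [Xx]|x [[Xx]|[Xx]]]; rewrite /= !in_itv/= ?andbT.
  + by case: (ltP x t) => xt sx; [left|right]; split => //; rewrite /= ?in_itv/= ?andbT ?sx ?xt.
  + by case/andP.
  + by move=> xs; split=> //; apply: le_trans xs.
- by apply: smallI.
- by apply: smallI.
- apply/seteqP; split => // x [[_]] /=; rewrite !in_itv/= => /andP[_ xt] [_].
  by rewrite andbT leNgt xt.
Qed.

Lemma after_le X Y s : small X -> small Y -> X `<=` Y -> after X s <= after Y s.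
Proof.
move=> sX sY XY; apply: len_le; [exact: smallI|exact: smallI|].
by move=> x [Xx ?]; split => //; exact: XY.
Qed.

(** The predicate [K] isolates the time spent on a subset of the jobs; with [xpredT] and the
    completion times of a schedule, this is its awake set. *)
Definition alive (n : nat) K a d : set R :=
  [set x | exists2 i, (i < n)%N && K i & a i <= x < d i].

Lemma small_alive n K a d : small (alive n K a d).
Proof.
elim: n => [|n ih].
  by rewrite (_ : alive _ _ _ _ = set0); [exact: small0|apply/seteqP; split => // x []].
have sK : small (if K n then [set` `[a n, d n[] else set0).
  by case: ifP => _; [exact: small_itv|exact: small0].
rewrite (_ : alive _ _ _ _ = alive n K a d `|` (if K n then [set` `[a n, d n[] else set0)).
  exact: smallU.
apply/seteqP; split => [x [i /andP[]]|x [[i /andP[ni Ki] ix]|]].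
- rewrite ltnS leq_eqVlt => /orP[/eqP -> Kn nx|ni Ki ix]; last first.
    by left; exists i => //; rewrite ni.
  by right; rewrite Kn /= in_itv.
- by exists i => //; rewrite ltnS ltnW.
- by case: ifP => // Kn; rewrite /= in_itv/= => nx; exists n => //; rewrite ltnSn.
Qed.

Lemma measurable_alive n K a d : measurable (alive n K a d).
Proof. by case: (small_alive n K a d). Qed.

Lemma alive_sub n K n' K' a d : (forall i, (i < n)%N && K i -> (i < n')%N && K' i) ->
  alive n K a d `<=` alive n' K' a d.
Proof. by move=> h x [i iK ix]; exists i => //; apply: h. Qed.

Lemma indic_itvE s t x : \1_(`[s, t[) x = (s <= x < t)%R%:R :> R.
Proof. by rewrite indicE mem_setE in_itv. Qed.

(** Double counting: integrate over [B] the number of intervals that contain the point. *)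
Lemma len_cover n K a d (p : nat) (B : set R) : small B ->
  (forall x, B x -> (p <= \sum_(i < n | K i) (a i <= x < d i)%R)%N) ->
  p%:R * len B <= \sum_(i < n | K i) len (`[a i, d i[ `&` B).
Proof.
move=> sB h; have [mB _] := sB.
have mI i : measurable `[a i, d i[ by exact: measurable_itv.
have mindic i : measurable_fun B (fun x => (\1_`[a i, d i[ x : R)%:E).
  by apply/measurable_EFinP; exact: measurable_indic.
rewrite -lee_fin -sumEFin EFinM -small_len// -integral_cst//.
have lenE i : (len (`[a i, d i[ `&` B))%:E =
    (\int[mu]_(x in B) (\1_`[a i, d i[ x)%:E)%E.
  by rewrite integral_indic// -small_len//; exact: smallI (small_itv _ _) mB.
under eq_bigr do rewrite lenE.
rewrite -[X in (_ <= X)%E]big_filter -ge0_integral_sum//.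
- apply: ge0_le_integral => //.
  + by move=> x _; rewrite lee_fin.
  + by apply: emeasurable_sum => i; exact: mindic.
  + move=> x /h px; rewrite big_filter sumEFin lee_fin.
    by under eq_bigr do rewrite indic_itvE; rewrite -natr_sum ler_nat.
- by move=> i; exact: mindic.
Qed.

End Length.

(** * Profiles of offline schedules *)

Section Profiles.
Local Open Scope classical_set_scope.
Local Open Scope ring_scope.
Variable R : realType.
Variables (p : nat) (w : nat -> task R).
Implicit Types (c : nat -> bool) (D : nat -> R) (K : pred nat) (i j k m q : nat).

Local Notation a := (fun i => arr (w i)).

Definition job c i : R := if c i then par (w i) else sig (w i).

(* What the analysis retains of an offline schedule of the first [m] tasks:
   its choices [c] and completion times [D]. *)
Definition profile m c D : Prop :=
  (forall i, (i < m)%N -> c i = false -> arr (w i) + sig (w i) <= D i) /\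
  (forall K, \sum_(i < m | K i) job c i <= p%:R * len (alive m K a D)).

(** Only profiles of the first [i.+1] tasks are consulted, so the rule can be evaluated when task
    [i] arrives. *)
Definition prefers_par i : Prop :=
  exists c D, profile i.+1 c D /\
    2 * after (alive i.+1 xpredT a D) (arr (w i)) < sig (w i).

Definition ch i : bool := `[< prefers_par i >].

Lemma profile_sub m k c D : (k <= m)%N -> profile m c D -> profile k c D.
Proof.
move=> km [h1 h2]; split => [i ik|K]; first exact: h1 _ (leq_trans ik km).
rewrite (big_ord_widen_cond m K (job c))//.
apply: (le_trans (h2 (fun i => K i && (i < k)%N))).
rewrite ler_wpM2l// len_le//; try exact: small_alive.
by apply: alive_sub => i /and3P[_ -> ->].
Qed.

Lemma serial_after m c D i : (i < m)%N -> profile m c D -> 0 <= sig (w i) ->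
  c i = false -> sig (w i) <= after (alive m xpredT a D) (arr (w i)).
Proof.
move=> im [h _] s0 /(h _ im) aD.
apply: le_trans (_ : len `[arr (w i), D i[ <= _).
  by rewrite len_itv; lra.
apply: len_le; [exact: small_itv|by apply: smallI; [exact: small_alive|exact: measurable_itv]|].
move=> x; rewrite /= ?in_itv/= => /andP[ax xD]; split; last by rewrite /= ?in_itv/= ax.
by exists i; rewrite ?im// ax xD.
Qed.

(** Were the serial job longer, the restriction of the profile to the tasks up to [i] would witness
    [prefers_par i]. *)
Lemma serial_le_after m c D i : (i < m)%N -> profile m c D -> ~~ ch i ->
  sig (w i) <= 2 * after (alive m xpredT a D) (arr (w i)).
Proof.
move=> im pr /asboolPn nch; rewrite leNgt; apply/negP => lt.
apply: nch; exists c, D; split; first exact: profile_sub pr.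
apply: le_lt_trans lt; rewrite ler_wpM2l//; apply: after_le; try exact: small_alive.
by apply: alive_sub => k /andP[ki _]; rewrite andbT; apply: leq_trans im.
Qed.

Variable n : nat.
Hypothesis arr_le : forall i j, (i <= j < n)%N -> arr (w i) <= arr (w j).

(** Arrivals being sorted, the tasks that arrive strictly before [t] form an initial segment, of
    length [q]. *)
Definition cutoff t q := (q <= n)%N /\ forall i, (i < n)%N -> (i < q)%N = (arr (w i) < t).

Lemma cutoff_exists t : exists q, cutoff t q.
Proof.
exists (find (fun i => t <= a i) (iota 0 n)).
have sz := find_size (fun i => t <= a i) (iota 0 n).
split=> [|i lt_in]; first by rewrite size_iota in sz.
apply/idP/idP => [/(before_find 0%N)|ait].
  by rewrite nth_iota//= add0n => /negbT; rewrite -ltNge.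
rewrite ltnNge; apply/negP => fi.
have fn : has (fun i => t <= a i) (iota 0 n) by rewrite has_find size_iota; exact: leq_ltn_trans lt_in.
have := nth_find 0%N fn; rewrite nth_iota ?add0n; last by rewrite has_find size_iota in fn.
by rewrite leNgt (le_lt_trans _ ait)// arr_le// fi.
Qed.

(** A substitute for the last moment satisfying [P], which need not exist: cutoffs are bounded by
    [n], so one of them is largest. *)
Lemma max_cutoff (P : R -> Prop) x0 : P x0 ->
  exists x q, [/\ P x, cutoff x q & forall y q', P y -> cutoff y q' -> (q' <= q)%N].
Proof.
move=> Px0; pose B k := `[< exists x, P x /\ cutoff x k >].
have exB : exists k, B k.
  by have [q cq] := cutoff_exists x0; exists q; apply/asboolP; exists x0.
have ubB k : B k -> (k <= n)%N by move=> /asboolP[x [_ []]].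
case: (ex_maxnP exB ubB) => q /asboolP[x [Px cx]] mx.
by exists x, q; split => // y q' Py cy; apply: mx; apply/asboolP; exists y.
Qed.

(* Follow the first profile on the tasks arriving before its last idle moment
   in [s, a_j], and the second one from then on. *)
Lemma hybrid m j c D c' D' s : (j < m <= n)%N -> s <= arr (w j) ->
  profile m c D -> profile j.+1 c' D' ->
  exists c2 D2, [/\ profile j.+1 c2 D2, c2 j = c' j &
    after (alive j.+1 xpredT a D2) s <=
      after (alive j.+1 xpredT a D') (arr (w j)) +
      len (alive m xpredT a D `&` `[s, arr (w j)[)].
Proof.
move=> /andP[jm mn] saj pr pr'.
pose idle x := (s <= x <= arr (w j)) /\ forall i, (i < m)%N -> arr (w i) < x -> D i <= x.
have busy x : s <= x <= arr (w j) -> ~ idle x -> alive m xpredT a D x.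
  move=> sx nid; apply: contrapT => nal; apply: nid; split => // i im ax.
  rewrite leNgt; apply/negP => xD; apply: nal.
  by exists i; rewrite ?im// (ltW ax).
have sma k K d : small (alive k K a d) := small_alive k K a d.
have smI k K d u v : small (alive k K a d `&` `[u, v[) by apply: smallI; [exact: small_alive|exact: measurable_itv].
(* Without an idle moment the first profile is awake on all of []s, arr (w j)[], which pays for
   whatever the second one does there. *)
have [[x0 idx0]|/forallNP noidle] := pselect (exists x, idle x); last first.
  exists c', D'; split => //; rewrite (after_seg (sma _ _ _) saj) addrC lerD2l.
  apply: le_trans (_ : len `]s, arr (w j)[ <= _).
    rewrite len_itvoo// -len_itv//; apply: len_le => [//||x []//]; exact: small_itv.
  apply: len_le => //; first exact: small_itvoo.
  move=> x; rewrite /= ?in_itv/= => /andP[sx xa]; split; last by rewrite /= ?in_itv/= (ltW sx).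
  by apply: busy (noidle x); rewrite !ltW.
have [x [q [[/andP[sx xa] idx] [qn cx] mx]]] := max_cutoff idx0.
have jn : (j < n)%N := leq_trans jm mn.
have qj : (q <= j)%N by rewrite leqNgt cx// -leNgt.
have xaq : x <= arr (w q) by rewrite leNgt -cx ?ltnn// (leq_ltn_trans qj).
have aqj : arr (w q) <= arr (w j) by apply: arr_le; rewrite qj.
pose c2 i := if (i < q)%N then c i else c' i.
pose D2 i := if (i < q)%N then D i else D' i.
have Dx i : (i < q)%N -> D i <= x.
  by move=> iq; have ij := leq_trans iq qj; apply: idx; rewrite -?cx//; lia.
have ax i : (i <= j)%N -> ~~ (i < q)%N -> arr (w q) <= arr (w i).
  by move=> ij; rewrite -leqNgt => qi; apply: arr_le; lia.
exists c2, D2; split; first last.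
(* The tasks taken from the first profile are finished by [x <= arr (w q)]; the others arrive at
   [arr (w q)] or later. The interval from there to [arr (w j)] is charged in full. *)
- apply: le_trans (_ : len (alive m xpredT a D `&` `[s, arr (w q)[) +
    (len `[arr (w q), arr (w j)[ + after (alive j.+1 xpredT a D') (arr (w j))) <= _).
    rewrite addrA; apply: (le_trans (len_leU _ (smallU (smI m xpredT D s (arr (w q)))
      (small_itv (arr (w q)) (arr (w j)))) (_ : small (alive j.+1 xpredT a D' `&` `[arr (w j), +oo[)) _)).
    + by apply: smallI; [exact: small_alive|exact: measurable_itv].
    + by apply: smallI; [exact: small_alive|exact: measurable_itv].
    + move=> y [[i]]; rewrite andbT ltnS => ij /andP[aiy]; rewrite /= !in_itv/= !andbT => yD2 sy.
      move: yD2; rewrite /D2; case: ifP => [iq yD|iq yD'].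
        left; left; split; first by exists i; rewrite ?aiy//; lia.
        by rewrite /= ?in_itv/= sy (lt_le_trans yD)// (le_trans (Dx _ iq)).
      have aqi := ax _ ij (negbT iq).
      have [yj|jy] := ltP y (arr (w j)).
        by left; right; rewrite /= ?in_itv/= andbT (le_trans aqi).
      by right; split; [exists i; rewrite ?aiy ?ltnS// andbT|rewrite /= ?in_itv/=].
    + rewrite lerD2r lenU//; [exact: small_itv|].
      apply/seteqP; split => // y [[_]]; rewrite /= !in_itv/= => /andP[_ yq] /andP[].
      by rewrite leNgt yq.
  rewrite addrA [leRHS]addrC lerD2r.
  have -> : alive m xpredT a D `&` `[s, arr (w j)[ =
    (alive m xpredT a D `&` `[s, arr (w q)[) `|` (alive m xpredT a D `&` `[arr (w q), arr (w j)[).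
    apply/seteqP; split => [y [Xy]|y [[Xy]|[Xy]]]; rewrite /= !in_itv/= => /andP[sy yj].
    + by case: (ltP y (arr (w q))) => ?; [left|right]; split => //; rewrite /= ?in_itv/=; apply/andP.
    + by split => //; rewrite sy (lt_le_trans yj).
    + by split => //; rewrite yj (le_trans sx)// (le_trans xaq).
  rewrite lenU//; last first.
    apply/seteqP; split => // y [[_]]; rewrite /= !in_itv/= => /andP[_ yq] [_ /andP[]].
    by rewrite leNgt yq.
  (* The full charge is legitimate: an idle moment after [arr (w q)] would have a cutoff above [q],
     so the first profile is awake throughout. *)
  rewrite lerD2l len_itv// -len_itvoo//; apply: len_le => //; first exact: small_itvoo.
  move=> y; rewrite /= ?in_itv/= => /andP[qy yj]; split; last by rewrite /= ?in_itv/= (ltW qy).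
  have sy : s <= y <= arr (w j) by apply/andP; split; [apply: le_trans sx (le_trans xaq (ltW qy))|exact: ltW].
  apply: busy => // idy; have [q' cy] := cutoff_exists y.
  by have := mx _ _ idy cy; case: cy => _ cy; rewrite leqNgt cy ?qy// (leq_ltn_trans qj).
- by rewrite /c2 ltnNge qj.
have prj := profile_sub jm pr.
split=> [i ij|K].
  by rewrite /c2 /D2; case: ifP => _; [apply: prj.1|apply: pr'.1].
(* The two groups of tasks are alive on disjoint sets, separated by [x], so their volume bounds add
   up. *)
rewrite (bigID (fun i : 'I__ => (i < q)%N))/=.
have -> : alive j.+1 K a D2 = alive j.+1 (fun i => K i && (i < q)%N) a D `|`
    alive j.+1 (fun i => K i && ~~ (i < q)%N) a D'.
  apply/seteqP; split => [y [i /andP[ij Ki]]|y [[i /and3P[ij Ki iq]]|[i /and3P[ij Ki iq]]]].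
  - by rewrite /D2; case: ifP => iq yD; [left|right]; exists i; rewrite ?ij ?Ki ?iq.
  - by move=> yD; exists i; rewrite ?ij ?Ki// /D2 iq.
  - by move=> yD; exists i; rewrite ?ij ?Ki// /D2 (negbTE iq).
rewrite lenU//; last first.
  apply/seteqP; split => // y [[i /and3P[ij Ki iq] /andP[_ yD]]] [k /and3P[kj _ kq] /andP[ay _]].
  have := Dx _ iq; have := ax _ kj kq; move: xaq yD ay => /=; lra.
rewrite mulrDr lerD//.
- apply: le_trans (prj.2 _); rewrite le_eqVlt; apply/orP; left; apply/eqP.
  by apply: eq_bigr => i /andP[_ iq]; rewrite /job /c2 iq.
- apply: le_trans (pr'.2 _); rewrite le_eqVlt; apply/orP; left; apply/eqP.
  by apply: eq_bigr => i /andP[_ /negbTE iq]; rewrite /job /c2 iq.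
Qed.

Hypothesis sig_gt0 : forall i, (i < n)%N -> 0 < sig (w i).

Definition par_load m s : R :=
  \sum_(i < m | ch i && (s <= arr (w i))) par (w i).

Lemma par_load_split j m s : (j < m)%N -> par_load m s =
  par_load j.+1 s + \sum_(i < m | [&& ch i, s <= arr (w i) & (j < i)%N]) par (w i).
Proof.
move=> jm; rewrite /par_load (bigID (fun i : 'I__ => (i < j.+1)%N))/=.
rewrite (big_ord_widen_cond m (fun i => ch i && (s <= arr (w i))) (fun i => par (w i)))//.
by congr (_ + _); apply: eq_bigl => i; rewrite -?andbA ?ltnS -?ltnNge.
Qed.

Lemma par_load_after m c D s : (m <= n)%N -> profile m c D ->
  par_load m s <= 2 * (p%:R * after (alive m xpredT a D) s).
Proof.
elim/ltn_ind: m c D => m ih.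
have smI k K d u v : small (alive k K a d `&` `[u, v[).
  by apply: smallI; [exact: small_alive|exact: measurable_itv].
(* Only the last task run serially by the profile in spite of [ch] matters:
   the tasks after it are charged to the profile, those up to it to a hybrid. *)
have step c D : (m <= n)%N -> profile m c D ->
    (forall j, (j < m)%N -> ch j -> s <= arr (w j) -> ~~ c j ->
      forall c2 D2, profile j.+1 c2 D2 -> c2 j ->
      par_load j.+1 s <= 2 * (p%:R * after (alive j.+1 xpredT a D2) s)) ->
    par_load m s <= 2 * (p%:R * after (alive m xpredT a D) s).
  move=> mn pr bnd.
  pose bad (j : nat) := [&& (j < m)%N, ch j, s <= arr (w j) & ~~ c j].
  (* Where the profile also runs these tasks in parallel, their parallel work is work that it
     performs itself after [s']. *)
  have late k s' : s <= s' -> (forall i, (i < m)%N -> ch i -> s <= arr (w i) -> (k <= i)%N ->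
      c i /\ s' <= arr (w i)) ->
    \sum_(i < m | [&& ch i, s <= arr (w i) & (k <= i)%N]) par (w i) <=
      p%:R * after (alive m xpredT a D) s'.
    move=> ss' h; pose K i := [&& ch i, s <= arr (w i) & (k <= i)%N].
    apply: le_trans (_ : \sum_(i < m | K i) job c i <= _).
      rewrite le_eqVlt; apply/orP; left; apply/eqP/eq_bigr => i /and3P[ci si ki].
      by rewrite /job (h _ (ltn_ord i) ci si ki).1.
    apply: (le_trans (pr.2 K)); rewrite ler_wpM2l//; apply: len_le.
    - exact: small_alive.
    - by apply: smallI; [exact: small_alive|exact: measurable_itv].
    - move=> x [i /andP[im /and3P[ci si ki]] /andP[ax xD]]; split.
        by exists i; rewrite ?im ?ax.
      by rewrite /= in_itv/= andbT (le_trans (h _ im ci si ki).2).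
  have [[j0 bj0]|/forallNP nobad] := pselect (exists j, bad j); last first.
    have -> : par_load m s = \sum_(i < m | [&& ch i, s <= arr (w i) & (0 <= i)%N]) par (w i).
      by apply: eq_bigl => i; rewrite andbT.
    have := late 0%N s (lexx _); set S := \sum_(i < _ | _) _ => h.
    have /h {h} : forall i, (i < m)%N -> ch i -> s <= arr (w i) -> (0 <= i)%N -> c i /\ s <= arr (w i).
      move=> i im ci si _; split => //; have := nobad i.
      by rewrite /bad im ci si => /negP; rewrite negbK.
    have : 0 <= p%:R * after (alive m xpredT a D) s by rewrite mulr_ge0// after_ge0.
    lra.
  have bm j : bad j -> (j <= m)%N by case/and4P => /ltnW.
  case: (ex_maxnP (ex_intro _ j0 bj0) bm) => j /and4P[jm cj sj ncj] mx.
  have jn : (j < n)%N := leq_trans jm mn.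
  have /asboolP[c' [D' [pr' lt']]] := cj.
  (* A serial run of [j] would by itself keep the witness awake for [sig (w j)] after the
     arrival. *)
  have c'j : c' j.
    apply/negPn/negP => /negbTE c'j.
    have := serial_after (ltnSn j) pr' (ltW (sig_gt0 jn)) c'j.
    by have := sig_gt0 jn; move: lt' => /=; lra.
  have jmn : (j < m <= n)%N by rewrite jm.
  have [c2 [D2 [pr2 c2j le2]]] := hybrid jmn sj pr pr'.
  have := bnd j jm cj sj ncj c2 D2 pr2; rewrite c2j => /(_ c'j) b2.
  rewrite (par_load_split _ jm).
  have /= sj_after := serial_after jm pr (ltW (sig_gt0 jn)) (negbTE ncj).
  have lj := late j.+1 (arr (w j)) sj.
  have /lj {}lj : forall i, (i < m)%N -> ch i -> s <= arr (w i) -> (j.+1 <= i)%N ->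
      c i /\ arr (w j) <= arr (w i).
    move=> i im ci si ji; split; last by rewrite arr_le// (ltnW ji) (leq_trans im).
    by apply/negPn/negP => nci; have := mx i; rewrite /bad im ci si nci leqNgt ji => /(_ isT).
  rewrite [in leRHS](after_seg (small_alive _ _ _ _) sj).
  have p0 : 0 <= p%:R :> R by [].
  move: le2 lt' b2 lj sj_after p0 => /=.
  set A := after _ _; set B := after _ _; set C := len _; set S := \sum_(i < _ | _) _.
  set Z := after _ _; set P := par_load _ _.
  move=> le2 lt' b2 lj sj_after p0.
  (* The hybrid is awake for [A <= B + C] after [s], with [2 * B < sig (w j) <= Z]. Hence
     [2 * p * A + p * Z <= 2 * p * (Z + C)]: the factor 2 reproduces itself. *)
  apply: le_trans (lerD b2 lj) _.
  have : p%:R * A <= p%:R * (Z / 2 + C) by rewrite ler_wpM2l//; lra.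
  lra.
move=> c D mn pr; apply: (step c D) => // j jm cj sj ncj c2 D2 pr2 c2j.
(* If [j] is the last task, the hybrid has as many tasks as before. As it runs [j] in parallel, its
   own last disagreement comes earlier, and a second application of [step] reaches the induction
   hypothesis. *)
have [jm1|jm1] := ltnP j.+1 m; first exact: (ih _ jm1 c2 D2 (leq_trans (ltnW jm1) mn) pr2).
have mj : m = j.+1 by lia.
subst m; apply: (step c2 D2) => // k km ck sk nck c3 D3 pr3 _; have kj : (k < j)%N.
  by rewrite ltn_neqAle -ltnS km andbT; apply: contraNneq nck => ->.
by apply: (ih k.+1 _ c3 D3) => //; lia.
Qed.

End Profiles.

(** * List scheduling of serial jobs *)

Section ListScheduling.
Local Open Scope classical_set_scope.
Local Open Scope ring_scope.
Variable R : realType.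
Variables (p : nat) (a sg : nat -> R) (ser : pred nat).
Implicit Types (x s t : R) (i j n : nat).

(* The earliest time from [x] on at which fewer than [p] of the completion
   times in [cs] are still to come. *)
Definition next_slot (cs : seq R) x : R :=
  Num.max x (nth x (sort (fun u v => v <= u) cs) p.-1).

Fixpoint ends i : seq R :=
  if i is j.+1 then
    if ser j then rcons (ends j) (next_slot (ends j) (a j) + sg j) else ends j
  else [::].

Definition start i : R := next_slot (ends i) (a i).
Definition fin i : R := start i + sg i.

Lemma count_ends (P : pred R) i :
  count P (ends i) = (\sum_(j < i | ser j) P (fin j))%N.
Proof.
elim: i => [|i ih]; first by rewrite big_ord0.
rewrite big_mkcond big_ord_recr -big_mkcond/= -ih.
by case: ifP => _; rewrite ?addn0// -cats1 count_cat/= addn0.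
Qed.

Lemma start_ge i : a i <= start i.
Proof. by rewrite /start /next_slot le_max lexx. Qed.

Hypothesis p_gt0 : (0 < p)%N.

Let geT : total (fun u v : R => v <= u).
Proof. by move=> u v; exact: le_total. Qed.

Let ge_trans : transitive (fun u v : R => v <= u).
Proof. by move=> u v y uv yu; apply: le_trans yu uv. Qed.

(** In decreasing order, the entries from index [p.-1] on do not exceed the slot; at most [p.-1]
    others remain. *)
Lemma next_slot_few cs x : (count (fun y => (next_slot cs x < y)%R) cs < p)%N.
Proof.
set z := next_slot cs x; set so := sort (fun u v : R => v <= u) cs.
have -> : count (fun y => z < y) cs = count (fun y => z < y) so.
  by apply/permP; rewrite perm_sym; apply/permPl/perm_sort.
rewrite -(cat_take_drop p.-1 so) count_cat.
have -> : count (fun y => z < y) (drop p.-1 so) = 0%N.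
  apply/eqP; rewrite -leqn0 leqNgt -has_count; apply/hasPn => y /(nthP x)[k].
  rewrite size_drop ltn_subRL => ks; rewrite nth_drop => <-; rewrite -leNgt.
  rewrite /z /next_slot le_max -/so; apply/orP; right.
  apply: (sorted_leq_nth ge_trans (@lexx _ R) x (sort_sorted geT cs)); rewrite ?inE ?leq_addr//.
  by apply: leq_ltn_trans ks; rewrite leq_addr.
rewrite addn0 (leq_ltn_trans (count_size _ _))// size_take_min.
by rewrite (leq_ltn_trans (geq_minl _ _))// prednK.
Qed.

Lemma next_slot_min cs x y : x <= y < next_slot cs x ->
  (p <= count (fun z => (y < z)%R) cs)%N.
Proof.
move=> /andP[xy]; rewrite /next_slot; set so := sort (fun u v : R => v <= u) cs.
rewrite lt_max ltNge xy/= => yn.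
have -> : count (fun z => y < z) cs = count (fun z => y < z) so.
  by apply/permP; rewrite perm_sym; apply/permPl/perm_sort.
(* With fewer than [p] entries, [nth] returns its default [x], and no [y >= x] lies before the
   slot. *)
have ps : (p.-1 < size so)%N.
  by rewrite ltnNge; apply/negP => h; move: yn; rewrite nth_default// ltNge xy.
rewrite -(cat_take_drop p so) count_cat (leq_trans _ (leq_addr _ _))//.
have szp : size (take p so) = p by rewrite size_takel// -(prednK p_gt0).
rewrite -[leqLHS]szp eq_leq//; apply/esym/eqP; rewrite -all_count.
apply/(all_nthP x) => k; rewrite szp => kp; rewrite nth_take//.
apply: lt_le_trans yn _.
apply: (sorted_leq_nth ge_trans (@lexx _ R) x (sort_sorted geT cs)); rewrite ?inE//.
  by apply: leq_ltn_trans ps; rewrite -ltnS prednK.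
by rewrite -ltnS prednK.
Qed.

Definition running n x : nat := (\sum_(j < n | ser j) (start j <= x < fin j)%R)%N.

(** If job [n] runs at [x], its start is past, and from the start on fewer than [p] earlier jobs are
    unfinished. *)
Lemma running_le n x : (running n x <= p)%N.
Proof.
elim: n => [|n ih]; first by rewrite /running big_ord0.
rewrite /running big_mkcond big_ord_recr -big_mkcond/=.
case: ifP => [sn|_]; last by rewrite addn0.
have [/andP[snx xn]|_] := boolP (start n <= x < fin n); last by rewrite addn0.
have := next_slot_few (ends n) (a n); rewrite -/(start n) count_ends addn1.
apply: leq_ltn_trans; apply: leq_sum => j _.
case: (boolP (start j <= x < fin j)) => // /andP[_ xj].
by rewrite (le_lt_trans snx).
Qed.

Variable n : nat.
Hypothesis a_le : forall i j, (i <= j < n)%N -> a i <= a j.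

(* FIFO order means that the first [p] unfinished jobs are the running ones. *)
Lemma running_ge m x : (m <= n)%N ->
  (minn p (\sum_(j < m | ser j) (a j <= x < fin j)%R) <= running m x)%N.
Proof.
elim: m => [|m ih] mn; first by rewrite /running !big_ord0 minn0.
have {}ih := ih (ltnW mn).
rewrite /running !(big_mkcond (fun i : 'I__ => ser i)) !big_ord_recr -!big_mkcond/=.
rewrite -/(running m x); set A := (\sum_(j < m | _) _)%N in ih *.
case: ifP => [sm|_]; last by rewrite !addn0.
have [/andP[amx xm]|_] := boolP (a m <= x < fin m); last first.
  by rewrite addn0 (leq_trans ih)// leq_addr.
rewrite xm andbT; have [_|xs] := leP (start m) x.
  by move: ih; rewrite !addn1; move: (running m x) => r; lia.
(* Job [m] is waiting at [x]: at least [p] earlier jobs are unfinished, and they have arrived too,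
   so the minimum is [p] even without [m]. *)
have := @next_slot_min (ends m) (a m) x; rewrite amx xs count_ends => /(_ isT) pA.
have {}pA : (p <= A)%N.
  apply: (leq_trans pA); apply: leq_sum => j _; case: ltP => //= xj.
  by rewrite andbT (le_trans _ amx)// a_le// ltnW//=.
rewrite addn0; apply: leq_trans (geq_minl _ _) _; apply: leq_trans ih.
by rewrite leq_min leqnn.
Qed.

Lemma waiting_running i x : (i < n)%N -> a i <= x < start i -> (p <= running i x)%N.
Proof.
move=> lt_in ix; apply: leq_trans (running_ge x (ltnW lt_in)); rewrite leq_min leqnn/=.
have := next_slot_min ix; rewrite count_ends => /leq_trans; apply; apply: leq_sum => j _.
case: ltP => //= xj; rewrite andbT; case/andP: ix => ax _.
by rewrite (le_trans _ ax)// a_le// lt_in ltnW.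
Qed.

Lemma few_started i x : (i < n)%N -> a i <= x ->
  (\sum_(j < i | ser j) (x < fin j)%R < p)%N -> start i <= x.
Proof.
move=> lt_in aix few; rewrite leNgt; apply/negP => xs.
have := @next_slot_min (ends i) (a i) x; rewrite aix xs count_ends => /(_ isT).
by rewrite leqNgt few.
Qed.

(** A serial job runs on one processor without preemption, so the elapsed running time is the work
    done before [x]. *)
Definition exec j x : R := before `[start j, fin j[ x.

Lemma exec_seg j s t : s <= t ->
  exec j t = exec j s + len (`[start j, fin j[ `&` `[s, t[).
Proof. exact/before_seg/small_itv. Qed.

Lemma exec_le j s t : s <= t -> exec j s <= exec j t.
Proof. exact/before_le/small_itv. Qed.

Lemma exec_early j x : x <= start j -> exec j x = 0.
Proof.
move=> xs; rewrite /exec /before (_ : _ `&` _ = set0) /len ?measure0//.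
apply/seteqP; split => // y []; rewrite /= !in_itv/= => /andP[sy _].
by rewrite ltNge (le_trans xs).
Qed.

Lemma exec_mid j x : 0 <= sg j -> start j <= x <= fin j -> exec j x = x - start j.
Proof.
move=> s0 /andP[sx xf]; rewrite -(len_itv sx); congr len; apply/seteqP; split => y.
  by move=> []; rewrite /= !in_itv/= => /andP[-> _].
rewrite /= !in_itv/= => /andP[sy yx]; split; rewrite /= ?in_itv//=.
by rewrite sy (lt_le_trans yx).
Qed.

Lemma exec_max j x : 0 <= sg j -> exec j x <= sg j.
Proof.
move=> s0; have [xs|sx] := leP x (start j); first by rewrite exec_early.
have [xf|fx] := leP x (fin j).
  by rewrite exec_mid ?(ltW sx)//; move: xf; rewrite /fin; lra.
have -> : sg j = len `[start j, fin j[ by rewrite len_itv /fin; lra.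
by apply: len_le => [||y []//]; [apply: smallI; [exact: small_itv|exact: measurable_itv]|exact: small_itv].
Qed.

Lemma exec_late j x : 0 <= sg j -> fin j <= x -> exec j x = sg j.
Proof.
move=> s0 fx; apply/eqP; rewrite eq_le exec_max//=.
by apply: le_trans (exec_le j fx); rewrite exec_mid// /fin; lra.
Qed.

(** Jobs that have not arrived by [x] count with their whole serial work. *)
Definition remaining m x : R := \sum_(j < m | ser j) (sg j - exec j x).

(** Each running job progresses at rate 1, so at least [p] units of work disappear per unit of time
    in [B]. *)
Lemma remaining_drop m s t (B : set R) : s <= t -> small B -> B `<=` `[s, t[ ->
  (forall x, B x -> (p <= running m x)%N) ->
  p%:R * len B <= remaining m s - remaining m t.
Proof.
move=> st sB Bst h; apply: (le_trans (len_cover sB h)).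
rewrite -sumrB; apply: ler_sum => j _.
rewrite (exec_seg j st) [leRHS](_ : _ = len (`[start j, fin j[ `&` `[s, t[)); last by lra.
by apply: len_le; [case: sB => ? _; exact: smallI (small_itv _ _) _|
  exact: smallI (small_itv _ _) (measurable_itv _)|move=> x [? /Bst]].
Qed.

End ListScheduling.

(** * Dependence of list scheduling on an initial segment of the tasks *)

Section Extensionality.
Variable R : realType.
Variables (p : nat) (a sg a' sg' : nat -> R) (ser ser' : pred nat) (q : nat).
Hypothesis ext : forall i, (i < q)%N -> [/\ a i = a' i, sg i = sg' i & ser i = ser' i].

Lemma ends_ext i : (i <= q)%N -> ends p a sg ser i = ends p a' sg' ser' i.
Proof. by elim: i => //= i ih iq; have [-> -> ->] := ext iq; rewrite ih// ltnW. Qed.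

Lemma start_ext i : (i < q)%N -> start p a sg ser i = start p a' sg' ser' i.
Proof. by move=> iq; rewrite /start ends_ext ?(ltnW iq)//; have [-> _ _] := ext iq. Qed.

Lemma fin_ext i : (i < q)%N -> fin p a sg ser i = fin p a' sg' ser' i.
Proof. by move=> iq; rewrite /fin start_ext//; have [_ -> _] := ext iq. Qed.

End Extensionality.

(** * The scheduler and its awake time *)

Section Scheduler.
Local Open Scope classical_set_scope.
Local Open Scope ring_scope.
Variable R : realType.
Variables (p : nat) (w : nat -> task R) (n : nat).
Implicit Types (x y s t g : R) (i j k q : nat).

Local Notation a := (fun i => arr (w i)).
Local Notation sg := (fun i => sig (w i)).
Local Notation ch := (ch p w).
Local Notation ser := (fun i => ~~ ch i).
Local Notation start := (start p a sg ser).
Local Notation fin := (fin p a sg ser).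
Local Notation exec := (exec p a sg ser).
Local Notation running := (running p a sg ser).
Local Notation remaining := (remaining p a sg ser).

Definition spare x : R := p%:R - (running n x)%:R.
(** A primitive of [spare] in closed form: what serial jobs leave over up to time [x]. *)
Definition capacity x : R := p%:R * x - \sum_(j < n | ser j) exec j x.

(* Parallel jobs are run in FIFO order: the [i]-th one occupies the interval
   from [onset i] to [onset i + par (w i)] of the scale given by [capacity]. *)
Fixpoint backlog i : R :=
  if i is j.+1 then
    if ch j then Num.max (capacity (arr (w j))) (backlog j) + par (w j)
    else backlog j
  else 0.
Definition onset i : R := Num.max (capacity (arr (w i))) (backlog i).

(** The first time at which [capacity] reaches [g]. As [capacity] is flat while [p] serial jobs run,
    it has no genuine inverse. *)
Definition instant g : R := sup [set x | capacity x < g].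

Definition completion i : R :=
  if ch i then instant (onset i + par (w i)) else fin i.

(** The arrival is tested separately because [capacity] may be flat just before it, so that
    [capacity x] can already equal [onset i]. *)
Definition share i x : R :=
  if ch i then
    if (arr (w i) <= x) && (onset i <= capacity x < onset i + par (w i))
    then spare x else 0
  else (start i <= x < fin i)%R%:R.

Hypothesis p_gt0 : (0 < p)%N.
Hypothesis arr_le : forall i j, (i <= j < n)%N -> arr (w i) <= arr (w j).
Hypothesis arr_ge0 : forall i, (i < n)%N -> 0 <= arr (w i).
Hypothesis sig_gt0 : forall i, (i < n)%N -> 0 < sig (w i).
Hypothesis sig_le_par : forall i, (i < n)%N -> sig (w i) <= par (w i).

Let sg0 i : (i < n)%N -> 0 <= sig (w i).
Proof. by move=> /sig_gt0/ltW. Qed.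

Let P0 : 0 < p%:R :> R. Proof. by rewrite ltr0n. Qed.

Lemma spare_ge0 x : 0 <= spare x.
Proof. by rewrite subr_ge0 ler_nat running_le. Qed.

Lemma measurable_itvb i (D : set R) : measurable_fun D (fun x => (start i <= x < fin i)%R%:R : R).
Proof.
by under eq_fun do rewrite -indic_itvE; exact: measurable_indic.
Qed.

Lemma runningE x : (running n x)%:R = \sum_(j < n | ser j) (start j <= x < fin j)%R%:R :> R.
Proof. by rewrite natr_sum. Qed.

Lemma measurable_spare (D : set R) : measurable_fun D spare.
Proof.
apply: measurable_funB; first exact: measurable_cst.
under eq_fun do rewrite runningE -big_filter.
by apply: measurable_sum => i; exact: measurable_itvb.
Qed.

(** Adding the indicators of the running serial jobs to [spare] gives the constant [p]; all terms
    are nonnegative, so the sum is integrated term by term. *)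
Lemma integral_spare s t : s <= t ->
  (\int[@lebesgue_measure R]_(x in `[s, t[) (spare x)%:E =
    (capacity t - capacity s)%:E)%E.
Proof.
move=> st; have mst : measurable `[s, t[ by exact: measurable_itv.
have mb i : measurable_fun `[s, t[ (fun x => (\1_`[start i, fin i[ x : R)%:E).
  by apply/measurable_EFinP; exact: measurable_indic.
have lenE i : (\int[@lebesgue_measure R]_(x in `[s, t[) (\1_`[start i, fin i[ x)%:E)%E =
    (exec i t - exec i s)%:E.
  rewrite integral_indic// (exec_seg _ _ _ _ _ st) addrAC subrr add0r.
  by apply: small_len; apply: smallI; [exact: small_itv|exact: measurable_itv].
have : (\int[@lebesgue_measure R]_(x in `[s, t[) ((spare x)%:E +
    \sum_(i <- [seq i : 'I_n <- index_enum 'I_n | ser i]) (\1_`[start i, fin i[ x)%:E) =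
    (p%:R * (t - s))%:E)%E.
  transitivity (\int[@lebesgue_measure R]_(x in `[s, t[) (cst (p%:R%:E) x))%E.
    apply: eq_integral => x _; rewrite big_filter sumEFin -EFinD /spare runningE.
    by under [X in _ + X]eq_bigr do rewrite indic_itvE; rewrite subrK.
  rewrite integral_cst// EFinM -(len_itv st); congr (_ * _)%E.
  exact: small_len (small_itv s t).
rewrite ge0_integralD//; first last.
- by apply: emeasurable_sum => i; exact: mb.
- by move=> x _; apply: sume_ge0 => i _; rewrite lee_fin.
- by apply/measurable_EFinP; exact: measurable_spare.
- by move=> x _; rewrite lee_fin spare_ge0.
rewrite ge0_integral_sum//; last by move=> i; exact: mb.
under [X in (_ + X)%E]eq_bigr do rewrite lenE.
rewrite sumEFin big_filter => h.
have := congr1 (fun z => (z - (\sum_(i < n | ser i) (exec i t - exec i s))%:E)%E) h.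
rewrite addeK// => ->; rewrite -EFinB; congr (_%:E).
by rewrite /capacity sumrB; lra.
Qed.

Lemma capacity_le s t : s <= t -> capacity s <= capacity t.
Proof.
move=> st; rewrite -subr_ge0 -lee_fin -integral_spare//.
by apply: integral_ge0 => x _; rewrite lee_fin spare_ge0.
Qed.

Lemma capacity_lip s t : s <= t -> capacity t <= capacity s + p%:R * (t - s).
Proof.
move=> st; rewrite /capacity.
have : \sum_(j < n | ser j) exec j s <= \sum_(j < n | ser j) exec j t.
  by apply: ler_sum => j _; exact: exec_le.
lra.
Qed.

Lemma capacity_neg x : x <= 0 -> capacity x = p%:R * x.
Proof.
move=> x0; rewrite /capacity big1 ?subr0// => j _; apply: exec_early.
by rewrite (le_trans x0)// (le_trans (arr_ge0 (ltn_ord j)))// start_ge.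
Qed.

(** The supremum is genuine: [capacity] is [p * x] for negative [x], and total serial work is
    finite. Strictness comes from the Lipschitz bound. *)
Lemma instant_lt g x : (x < instant g) = (capacity x < g).
Proof.
have ne : [set y | capacity y < g] !=set0.
  exists (Num.min 0 (g / p%:R - 1)); rewrite /= capacity_neg; last by rewrite ge_min lexx.
  apply: (@le_lt_trans _ _ (p%:R * (g / p%:R - 1))).
    by rewrite ler_pM2l// ge_min lexx orbT.
  by rewrite mulrBr mulrCA divff ?gt_eqF// !mulr1; move: P0; lra.
have ub : has_ubound [set y | capacity y < g].
  exists ((g + \sum_(j < n | ser j) sig (w j)) / p%:R) => y /= cg.
  rewrite ler_pdivlMr// mulrC.
  have : \sum_(j < n | ser j) exec j y <= \sum_(j < n | ser j) sig (w j).
    by apply: ler_sum => j _; apply: exec_max; exact: sg0.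
  by move: cg; rewrite /capacity; lra.
apply/idP/idP => [xi|cg].
  have [y /= cy xy] := sup_gt ne xi.
  by apply: le_lt_trans cy; apply/capacity_le/ltW.
(* At slope at most [p], [capacity] closes at most half of the gap to [g] during [e]. *)
pose e := (g - capacity x) / p%:R / 2.
have e0 : 0 < e by rewrite !divr_gt0// subr_gt0.
apply: (@lt_le_trans _ _ (x + e)); first by rewrite ltrDl.
have xe : x <= x + e by rewrite lerDl ltW.
apply: ub_le_sup => //=; apply: le_lt_trans (capacity_lip xe) _.
rewrite [x + e]addrC addrK /e mulrA mulrCA divff ?gt_eqF// mulr1.
by move: cg; lra.
Qed.

Lemma capacity_instant g : capacity (instant g) = g.
Proof.
apply/eqP; rewrite eq_le [X in _ && X]leNgt -instant_lt ltxx andbT.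
apply/ler_addgt0Pr => e e0; set z := instant g.
have ep : 0 < e / p%:R by rewrite divr_gt0.
have : z - e / p%:R < z by rewrite ltrBlDr ltrDl.
rewrite instant_lt => h.
have zz : z - e / p%:R <= z by rewrite gerBl ltW.
apply: le_trans (capacity_lip zz) _; rewrite subKr.
by rewrite mulrCA divff ?gt_eqF// mulr1; move: h; lra.
Qed.

(** Unrolling the maxima leads back to a parallel job [k] that found no backlog; from its arrival on
    the parallel jobs leave no gap. *)
Lemma backlog_chain i : (i <= n)%N -> backlog i = 0 \/
  exists k, [/\ (k < i)%N, ch k &
    backlog i <= capacity (arr (w k)) + \sum_(j < i | ch j && (k <= j)%N) par (w j)].
Proof.
elim: i => [|i ih] lt_in; first by left.
rewrite /=; case: ifP => ci; last first.
  case: (ih (ltnW lt_in)) => [->|[k [ki ck le]]]; [by left|right; exists k; split => //].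
    exact: ltnW.
  by rewrite big_mkcond big_ord_recr -big_mkcond/= ci addr0.
right; have [le|lt] := leP (backlog i) (capacity (arr (w i))).
  exists i; split => //; rewrite lerD2l big_mkcond big_ord_recr -big_mkcond/= ci leqnn/=.
  rewrite lerDr; apply: sumr_ge0 => j _.
  have jn : (j < n)%N by rewrite (ltn_trans (ltn_ord j)).
  exact: le_trans (sg0 jn) (sig_le_par jn).
case: (ih (ltnW lt_in)) => [b0|[k [ki ck le]]].
  have := capacity_le (arr_ge0 lt_in); rewrite capacity_neg// mulr0.
  by move: lt; rewrite b0 => /lt_le_trans h /h; rewrite ltxx.
exists k; split => //; first exact: ltnW.
by rewrite big_mkcond big_ord_recr -big_mkcond/= ci (ltnW ki)/= addrA lerD2r.
Qed.

Lemma onset_chain i : (i < n)%N -> ch i -> exists k, [/\ (k <= i)%N, ch k &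
  onset i + par (w i) <=
    capacity (arr (w k)) + \sum_(j < i.+1 | ch j && (k <= j)%N) par (w j)].
Proof.
move=> lt_in ci; have [/= |[k []]] := backlog_chain lt_in.
  rewrite ci -/(onset i) => h; have := capacity_le (arr_ge0 lt_in).
  have : capacity (arr (w i)) <= onset i by rewrite le_max lexx.
  have := sig_gt0 lt_in; have := sig_le_par lt_in.
  by rewrite (capacity_neg (lexx 0)) mulr0; move: h; lra.
by rewrite /= ci => ki ck h; exists k.
Qed.

Lemma completion_ge i : (i < n)%N -> arr (w i) <= completion i.
Proof.
move=> lt_in; rewrite /completion; case: ifP => ci; last first.
  by apply: le_trans (start_ge p a sg ser i) _; rewrite lerDl sg0.
apply: ltW; rewrite instant_lt; apply: (@le_lt_trans _ _ (onset i)); first by rewrite le_max lexx.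
by rewrite ltrDl (lt_le_trans (sig_gt0 lt_in))// sig_le_par.
Qed.


Variables (c : nat -> bool) (D : nat -> R).
Hypothesis prof : profile p w n c D.

Let U : set R := alive n xpredT a D.
Let V : set R := alive n xpredT a completion.
Let E := before V.
Let Y := before U.

Let sU : small U. Proof. exact: small_alive. Qed.
Let sV : small V. Proof. exact: small_alive. Qed.

(** The times at which the offline profile is idle; the main induction runs on [q]. *)
Definition settled t q : Prop := cutoff w n t q /\ forall i, (i < q)%N -> D i <= t.

Lemma after_settled t q s : settled t q -> s <= t ->
  after (alive q xpredT a D) s <= Y t - Y s.
Proof.
move=> [[qn _] Dt] st; rewrite /Y (before_seg sU st) addrAC subrr add0r.
apply: len_le; [by apply: smallI; [exact: small_alive|exact: measurable_itv]|
  by apply: smallI; [exact: small_alive|exact: measurable_itv]|].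
move=> x [[i /andP[iq _] /andP[ax xD]]]; rewrite /= in_itv/= andbT => sx; split.
  by exists i; rewrite ?andbT ?ax// (leq_trans iq).
by rewrite /= in_itv/= sx (lt_le_trans xD)// Dt.
Qed.

(** Since [sig <= par], the profile does at least the serial work of each of these tasks whatever it
    chose, and does it between [v] and [t]. *)
Lemma serial_load_settled t q q1 v : settled t q -> v <= t ->
  (forall j, (q1 <= j < q)%N -> v <= arr (w j)) ->
  \sum_(j < q | ser j && (q1 <= j)%N) sig (w j) <= p%:R * (Y t - Y v).
Proof.
move=> st vt h; have [[qn _] Dt] := st.
pose K j := ser j && (q1 <= j)%N.
apply: le_trans (_ : \sum_(j < q | K j) job w c j <= _).
  apply: ler_sum => j _; rewrite /job; case: ifP => // _.
  by apply: sig_le_par; exact: leq_trans qn.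
have [_ /(_ K) le] := profile_sub qn prof; apply: (le_trans le).
rewrite ler_wpM2l//; apply: le_trans (after_settled st vt); apply: len_le.
- exact: small_alive.
- by apply: smallI; [exact: small_alive|exact: measurable_itv].
- move=> x [j /andP[jq /andP[_ q1j]] /andP[ax xD]]; split; first by exists j; rewrite ?jq ?ax.
  by rewrite /= in_itv/= andbT (le_trans _ ax)// h// q1j.
Qed.

(** The first clause covers the time until a serial job ends, possibly after [t]; it bounds what is
    left of that job at an idle moment. *)
Let bounded q : Prop := forall t, settled t q ->
  (forall i, (i < q)%N -> ser i -> E (arr (w i)) + (fin i - arr (w i)) <= 3 * Y t) /\
  E t <= 3 * Y t.

Lemma remaining_term_ge0 i x : (i < n)%N -> 0 <= sig (w i) - exec i x.
Proof. by move=> lt_in; rewrite subr_ge0 exec_max// sg0. Qed.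

Lemma remaining_ge0 q x : (q <= n)%N -> 0 <= remaining q x.
Proof.
by move=> qn; apply: sumr_ge0 => i _; apply: remaining_term_ge0; exact: leq_trans qn.
Qed.

Lemma remaining_mono i q x : (i <= q <= n)%N -> remaining i x <= remaining q x.
Proof.
move=> /andP[iq qn]; rewrite /remaining.
rewrite (big_ord_widen_cond q (fun j => ser j) (fun j => sig (w j) - exec j x))//.
rewrite big_mkcond [leRHS]big_mkcond; apply: ler_sum => j _.
have := @remaining_term_ge0 j x (leq_trans (ltn_ord j) qn).
by case: ifP => [/andP[-> _]//|_]; case: ifP.
Qed.

(* Work remaining at a settled time [v] with fewer than [p] serial jobs alive:
   these all run, and end within [3 * Y v - E v]. *)
Lemma remaining_settled q1 q v t : bounded q1 -> settled v q1 -> settled t q ->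
  (q1 <= q)%N -> v <= t ->
  (\sum_(j < n | ser j) (arr (w j) < v < fin j)%R < p)%N ->
  remaining q v <= p%:R * (3 * Y v - E v) + p%:R * (Y t - Y v).
Proof.
move=> bq1 sv st q1q vt few; have [X1 X2] := bq1 _ sv.
have [[qn ct] Dt] := st; have [[q1n cv] Dv] := sv.
rewrite /remaining (bigID (fun j : 'I__ => (j < q1)%N))/=; apply: lerD; last first.
  under eq_bigl do rewrite -leqNgt.
  apply: le_trans (serial_load_settled (q1 := q1) st vt _).
    apply: ler_sum => j _; rewrite gerBl; exact: len_ge0.
  move=> j /andP[q1j jq]; have jn := leq_trans jq qn.
  by rewrite leNgt -cv// -leqNgt.
set M := 3 * Y v - E v; have M0 : 0 <= M by rewrite subr_ge0.
(* Fewer than [p] of the old jobs are alive at [v], so all of these have started. Each has at most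
   [M] left, because [E v <= E (arr (w j)) + (v - arr (w j))]. *)
apply: le_trans (_ : \sum_(j < q | ser j && (j < q1)%N) (arr (w j) < v < fin j)%R%:R * M <= _).
  apply: ler_sum => j /andP[sj jq1]; have jn : (j < n)%N := leq_trans (ltn_ord j) qn.
  have av : arr (w j) < v by rewrite -cv.
  rewrite av/=; have [vf|fv] := ltP v (fin j); last by rewrite exec_late ?sg0// subrr mul0r.
  have sv' : start j <= v.
    apply: (few_started p_gt0 (n := n)) => //; first exact: ltW.
    apply: leq_ltn_trans few.
    rewrite (big_ord_widen_cond n (fun i => ser i) (fun i => (v < fin i)%R : nat)) ?(ltnW jn)//.
    rewrite big_mkcond [leqRHS]big_mkcond; apply: leq_sum => i _.
    case: ifP => // /andP[-> ij]; rewrite (le_lt_trans _ av)// arr_le// jn andbT.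
    exact: ltnW.
  rewrite mul1r exec_mid ?sg0//; last by rewrite sv' ltW.
  have f1 : E v <= E (arr (w j)) + (v - arr (w j)) := before_lip sV (ltW av).
  have := X1 _ jq1 sj; move: f1; rewrite /M /fin; lra.
rewrite -mulr_suml ler_wpM2r// -natr_sum ler_nat (leq_trans _ (ltnW few))//.
rewrite (big_ord_widen_cond n (fun j => ser j && (j < q1)%N) (fun j => (arr (w j) < v < fin j)%R : nat))//.
rewrite big_mkcond [leqRHS]big_mkcond; apply: leq_sum => i _.
by case: ifP => // /andP[/andP[-> _]].
Qed.

(* Between [v], the last moment where the profile is idle and fewer than [p]
   serial jobs are alive, and the arrival of [k], the left-hand side can only
   grow while the profile is awake. *)
Lemma arrival_bound q t k : (forall q1, (q1 < q)%N -> bounded q1) -> settled t q ->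
  (k < q)%N ->
  E (arr (w k)) + remaining q (arr (w k)) / p%:R <= 2 * Y (arr (w k)) + Y t.
Proof.
move=> ih st kq; have [[qn ct] Dt] := st; set r := arr (w k).
have kn := leq_trans kq qn.
have rt : r < t by rewrite -ct.
pose slack v := [/\ v <= r, forall i, (i < n)%N -> arr (w i) < v -> D i <= v &
  (\sum_(j < n | ser j) (arr (w j) < v < fin j)%R < p)%N].
have n0 : (0 < n)%N := leq_ltn_trans (leq0n k) kn.
have first i : (i < n)%N -> (arr (w i) < arr (w 0)) = false.
  by move=> lt_in; apply/negbTE; rewrite -leNgt arr_le// leq0n.
have slack0 : slack (arr (w 0)).
  split; first by apply: arr_le; rewrite leq0n kn.
  - by move=> i lt_in; rewrite first.
  - by rewrite big1// => j _; rewrite first.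
have [v1 [q1 [[v1r Dv1 few1] cv1 mx]]] := max_cutoff arr_le slack0.
have q1k : (q1 <= k)%N by rewrite leqNgt (cv1.2 _ kn) -leNgt.
have q1n := leq_ltn_trans q1k kn.
(* No task arrives from [v1] until [v], so the slack conditions persist at [v]; by maximality they
   fail at every time strictly between [v] and [r]. *)
set v := arr (w q1).
have v1v : v1 <= v by rewrite leNgt -(cv1.2 _ q1n) ltnn.
have vr : v <= r by apply: arr_le; rewrite q1k.
have cv : cutoff w n v q1.
  split=> [|i lt_in]; first exact: ltnW.
  apply/idP/idP => [iq1|]; first by apply: lt_le_trans v1v; rewrite -(cv1.2 _ lt_in).
  by apply: contraTT; rewrite -leqNgt -leNgt => q1i; apply: arr_le; rewrite q1i.
have Dv i : (i < q1)%N -> D i <= v.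
  move=> iq1; have lt_in := ltn_trans iq1 q1n.
  by apply: le_trans v1v; apply: Dv1 => //; rewrite -(cv1.2 _ lt_in).
have few : (\sum_(j < n | ser j) (arr (w j) < v < fin j)%R < p)%N.
  apply: leq_ltn_trans few1; apply: leq_sum => j _.
  case: (boolP (arr (w j) < v < fin j)) => // /andP[jv vf].
  by rewrite -(cv1.2 _ (ltn_ord j)) (cv.2 _ (ltn_ord j)) jv (le_lt_trans v1v).
(* With fewer than [p] jobs running, FIFO order would leave fewer than [p] alive, and [x] would be
   slack. *)
have tight x : v < x < r -> ~ U x -> (p <= running q x)%N.
  move=> /andP[vx xr] nU; rewrite leqNgt; apply/negP => run.
  have [q' cx] := cutoff_exists arr_le x.
  have /mx/(_ cx) : slack x.
    split; first exact: ltW.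
      move=> i lt_in ax; rewrite leNgt; apply/negP => xD; apply: nU.
      by exists i; rewrite ?andbT// (ltW ax).
    have := running_ge sg ser p_gt0 arr_le x qn => /=; set A := (\sum_(j < q | _) _)%N => h.
    have Ap : (A < p)%N.
      by rewrite ltnNge; apply/negP => /minn_idPl pA; move: run; rewrite ltnNge -{1}pA h.
    apply: leq_ltn_trans Ap; rewrite /A.
    rewrite (big_ord_widen_cond n (fun j => ser j) (fun j => (arr (w j) <= x < fin j)%R : nat))//.
    rewrite big_mkcond [leqRHS]big_mkcond; apply: leq_sum => j _.
    case: ifP => //= sj; case: (boolP (arr (w j) < x < fin j)) => // /andP[jx xf].
    have jq : (j < q)%N by rewrite ct// (lt_trans jx)// (lt_trans xr).
    by rewrite jq (ltW jx) xf.
  by rewrite leqNgt (cx.2 _ q1n) vx.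
pose B := `]v, r[ `\` U.
have sB : small B.
  apply: small_sub (small_itvoo v r) => [|x []//].
  by apply: measurableD; [exact: measurable_itv|exact: measurable_alive].
have dB : p%:R * len B <= remaining q v - remaining q r.
  apply: remaining_drop => // [x []|x [xvr nU]].
    by rewrite /= !in_itv/= => /andP[vx ->]; rewrite (ltW vx).
  by apply: tight => //; move: xvr; rewrite /= in_itv.
have rv : r - v <= (Y r - Y v) + len B.
  have -> : Y r - Y v = len (U `&` `[v, r[).
    by rewrite /Y (before_seg sU vr) addrAC subrr add0r.
  rewrite -len_itvoo//.
  apply: len_leU => //; [exact: small_itvoo|by apply: smallI; [|exact: measurable_itv]|].
  move=> x xvr; have [xU|nxU] := pselect (U x); [left|by right].
  by split => //; move: xvr; rewrite /= !in_itv/= => /andP[vx ->]; rewrite (ltW vx).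
have vt : v <= t by rewrite ltW// (le_lt_trans vr).
have q1q := leq_ltn_trans q1k kq.
(* Bounding [E r] by [E v + (r - v)], the terms [E v] and [len B] cancel: the left-hand side is at
   most [Y v + Y r + Y t], and [Y v <= Y r]. *)
have := remaining_settled (ih _ q1q) (conj cv Dv) st (ltnW q1q) vt few.
have := before_lip sV vr; have := before_le sU vr; rewrite -/E -/Y => Yvr Evr rem.
have {}rem : remaining q r / p%:R <= (3 * Y v - E v) + (Y t - Y v) - len B.
  by rewrite ler_pdivrMr//; lra.
by lra.
Qed.

Lemma all_bounded q : bounded q.
Proof.
elim/ltn_ind: q => q ih t st; have [[qn ct] Dt] := st.
have claim k (kq : (k < q)%N) := arrival_bound ih st kq.
have X1 i : (i < q)%N -> ser i -> E (arr (w i)) + (fin i - arr (w i)) <= 3 * Y t.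
  move=> iq si; have lt_in := leq_trans iq qn.
  have ait : arr (w i) <= t by rewrite ltW// -ct.
  have le1 : sig (w i) <= 2 * (Y t - Y (arr (w i))).
    apply: le_trans (serial_le_after iq (profile_sub qn prof) si) _.
    by rewrite ler_wpM2l// after_settled.
  (* While [i] waits, all processors serve earlier serial jobs. *)
  have le2 : p%:R * (start i - arr (w i)) <= remaining q (arr (w i)).
    apply: le_trans (remaining_mono (arr (w i)) (_ : (i <= q <= n)%N)); last by rewrite ltnW.
    have sai := start_ge p a sg ser i.
    have wait x : [set` `[arr (w i), start i[] x -> (p <= running i x)%N.
      by rewrite /= in_itv/=; apply: (waiting_running p_gt0 arr_le lt_in).
    rewrite -len_itv//; apply: (le_trans (remaining_drop sai (small_itv _ _) _ wait)) => //.
    by rewrite gerBl remaining_ge0// ltnW.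
  have {}le2 : start i - arr (w i) <= remaining q (arr (w i)) / p%:R.
    by rewrite ler_pdivlMr// mulrC.
  by have := claim i iq; rewrite /fin; lra.
split=> //.
have [q0|q_gt0] := posnP q.
  rewrite [E t](_ : _ = 0); first by rewrite mulr_ge0// before_ge0.
  rewrite /E /before (_ : _ `&` _ = set0) /len ?measure0//.
  apply/seteqP; split => // x [[i /andP[lt_in _] /andP[ax _]]]; rewrite /= in_itv/= => xt.
  by have := ct _ lt_in; rewrite (le_lt_trans ax)// q0.
(* The last of the [q] tasks to complete: past [y] and before [t] nothing is alive, so [E t] is
   controlled by any earlier time plus the distance to [y]. *)
pose i := [arg max_(j > Ordinal q_gt0) completion j]%O.
have imax j : (j < q)%N -> completion j <= completion i.
  by move=> jq; rewrite /i; case: arg_maxP => //= k _ /(_ (Ordinal jq) isT).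
have iq : (i < q)%N := ltn_ord i.
have lt_in := leq_trans iq qn.
have ait : arr (w i) <= t by rewrite ltW// -ct.
pose y := Num.min t (completion i).
have yt : y <= t by rewrite ge_min lexx.
have yC : y <= completion i by rewrite ge_min lexx orbT.
have Ey s : s <= y -> E t <= E s + (y - s).
  move=> sy; rewrite /E (before_seg sV (le_trans sy yt)) lerD2l -len_itv//.
  apply: len_le; [by apply: smallI; [|exact: measurable_itv]|exact: small_itv|].
  move=> x [[j /andP[jn _] /andP[ax xC]]]; rewrite /= !in_itv/= => /andP[-> xt] /=.
  rewrite lt_min xt (lt_le_trans xC)// imax// ct//; exact: le_lt_trans xt.
have [ci|si] := boolP (ch i); last first.
  have aiy : arr (w i) <= y by rewrite le_min ait completion_ge.
  have := X1 i iq si; have := Ey _ aiy; move: yC.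
  by rewrite /completion (negbTE si); lra.
(* From the arrival of [k] until [y], the processor time splits into spare capacity, at most the
   parallel load of the chain, and serial work, at most what remained at that arrival. *)
have [k [ki ck chain]] := onset_chain lt_in ci.
have kq := leq_ltn_trans ki iq; have kn := leq_trans kq qn.
have akt : arr (w k) <= t by rewrite ltW// -ct.
have aky : arr (w k) <= y.
  by rewrite le_min akt (le_trans _ (completion_ge lt_in))// arr_le// ki.
have load : \sum_(j < i.+1 | ch j && (k <= j)%N) par (w j) <=
    2 * (p%:R * (Y t - Y (arr (w k)))).
  apply: le_trans (_ : par_load p w q (arr (w k)) <= _); last first.
    apply: le_trans (par_load_after arr_le sig_gt0 _ qn (profile_sub qn prof)) _.
    by rewrite ler_wpM2l// ler_wpM2l// after_settled.
  rewrite (big_ord_widen_cond q (fun j => ch j && (k <= j)%N) (fun j => par (w j)))//.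
  rewrite /par_load big_mkcond [leRHS]big_mkcond; apply: ler_sum => j _.
  have jn : (j < n)%N := leq_trans (ltn_ord j) qn.
  have pj : 0 <= par (w j) := le_trans (sg0 jn) (sig_le_par jn).
  case: ifP => [/andP[/andP[-> kj] _]|_]; last by case: ifP.
  by rewrite arr_le ?kj.
have cy : capacity y <= onset i + par (w i).
  by rewrite -(capacity_instant (onset i + par (w i))) capacity_le//; move: yC; rewrite /completion ci.
have drain : \sum_(j < n | ser j) (exec j y - exec j (arr (w k))) <= remaining q (arr (w k)).
  rewrite /remaining (big_ord_widen_cond n (fun j => ser j) (fun j => sig (w j) - exec j (arr (w k))))//.
  rewrite big_mkcond [leRHS]big_mkcond; apply: ler_sum => j _.
  have jn := ltn_ord j.
  case: ifP => //= _; case: ifP => jq; first by rewrite lerD2r exec_max// sg0.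
  (* Jobs from index [q] on arrive at [t] or later, so none of them is executed before [y]. *)
  rewrite exec_early ?sub0r ?oppr_le0; first exact: len_ge0.
  apply: le_trans (start_ge p a sg ser j); apply: (le_trans yt).
  by rewrite leNgt -ct// jq.
have cap : p%:R * (y - arr (w k)) <= remaining q (arr (w k)) + 2 * (p%:R * (Y t - Y (arr (w k)))).
  have : capacity y - capacity (arr (w k)) =
      p%:R * (y - arr (w k)) - \sum_(j < n | ser j) (exec j y - exec j (arr (w k))).
    by rewrite /capacity sumrB; lra.
  by move: cy chain load drain; lra.
have {}cap : y - arr (w k) <= remaining q (arr (w k)) / p%:R + 2 * (Y t - Y (arr (w k))).
  have : p%:R * (remaining q (arr (w k)) / p%:R) = remaining q (arr (w k)).
    by rewrite mulrC divfK// gt_eqF.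
  set Q := remaining q _ / _ => QE; rewrite -(ler_pM2l P0); move: cap; rewrite -QE; lra.
by have := claim k kq; have := Ey _ aky; lra.
Qed.

Lemma total_bound : len V <= 3 * len U.
Proof.
(* A time beyond all arrivals and completions, where [E] and [Y] are the total awake times. *)
pose t := \sum_(i < n) (`|arr (w i)| + `|D i| + `|completion i|) + 1.
have big i : (i < n)%N -> [/\ arr (w i) < t, D i < t & completion i < t].
  move=> lt_in; rewrite /t (bigD1 (Ordinal lt_in))//=.
  have := ler_norm (arr (w i)); have := ler_norm (D i); have := ler_norm (completion i).
  have := normr_ge0 (arr (w i)); have := normr_ge0 (D i); have := normr_ge0 (completion i).
  set S := \sum_(_ < n | _) _; have : 0 <= S by apply: sumr_ge0 => j _; rewrite !addr_ge0.
  by split; lra.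
have st : settled t n.
  split; last by move=> i /big[_ /ltW].
  by split => // i lt_in; rewrite lt_in; have [-> _ _] := big i lt_in.
have whole X d : X = alive n xpredT a d -> (forall i, (i < n)%N -> d i < t) -> before X t = len X.
  move=> -> dt; congr len; apply/seteqP; split => [x []//|x [i /andP[lt_in _] /andP[ax xd]]].
  split; first by exists i; rewrite ?lt_in ?ax.
  by rewrite /= in_itv/= (lt_trans xd) ?dt.
have := (all_bounded st).2; rewrite /E /Y !(whole _ _ erefl)//.
  by move=> i /big[].
by move=> i /big[].
Qed.

End Scheduler.

(** * Feasibility and online behaviour *)

Section Feasible.
Local Open Scope classical_set_scope.
Local Open Scope ring_scope.
Variable R : realType.
Variables (p : nat) (T : TAP R).
Notation mu := (@lebesgue_measure R).
Local Notation a := (fun i => arr (tsk T i)).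

Lemma awakeE (S : schedule R) :
  awake T S = (len (alive (size T) xpredT a (compl S)))%:E.
Proof.
rewrite -small_len; last exact: small_alive.
congr (mu _); apply/seteqP; split => x [i h ix]; exists i => //; rewrite ?andbT// in h *.
Qed.

(** A serial job progresses at rate at most 1. The jobs in [K] receive processors only while one of
    them is alive, up to null sets, and at most [p] in total. *)
Lemma feasible_profile (S : schedule R) : feasible p T S ->
  profile p (tsk T) (size T) (Defs.choice S) (compl S).
Proof.
move=> [cap each]; split => [i /each[ma [aD [a0 [_ [ser [wk _]]]]]] ci|K].
  rewrite -lerBrDl -lee_fin; move: wk; rewrite /work ci => <-.
  apply: le_trans (_ : (\int[mu]_(x in `[arr (tsk T i), compl S i]) cst 1%E x <= _)%E).
    apply: ge0_le_integral => //.
    - by move=> x _; rewrite lee_fin.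
    - by apply/measurable_EFinP; apply: measurable_funS ma.
    - by move=> x _; rewrite lee_fin ser.
  rewrite integral_cst// mul1e; apply: le_trans (_ : mu `[arr (tsk T i), compl S i] <= _)%E => //.
  rewrite lebesgue_measure_itv/= lte_fin.
  by case: ifP => _; rewrite ?lee_fin ?subr_ge0.
have mA := measurable_alive (size T) K a (compl S).
rewrite -lee_fin EFinM -(small_len (small_alive _ _ _ _)) -integral_cst//.
have mS (i : 'I_(size T)) (B : set R) : measurable_fun B (fun x => (alloc S i x)%:E).
  by have [ma _] := each _ (ltn_ord i); apply/measurable_EFinP; apply: measurable_funS ma.
apply: le_trans (_ : (\sum_(i < size T | K i)
    \int[mu]_(x in alive (size T) K a (compl S)) (alloc S i x)%:E <= _)%E).
  rewrite -sumEFin; apply: lee_sum => i Ki.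
  have [ma [_ [a0 [_ [_ [wk _]]]]]] := each _ (ltn_ord i).
  rewrite [(job _ _ _)%:E](_ : _ = (work T S i)%:E)// -wk.
  rewrite -integral_itv_bndo_bndc; last exact: mS.
  apply: ge0_subset_integral => //.
  - exact: mS.
  - by move=> x _; rewrite lee_fin.
  - by move=> x; rewrite /= in_itv/= => ix; exists i; rewrite ?Ki ?ltn_ord.
rewrite -big_filter -ge0_integral_sum//; [|by move=> i; exact: mS|].
  2: by move=> i x _; have [_ [_ [a0 _]]] := each _ (ltn_ord i); rewrite lee_fin.
apply: ge0_le_integral => //.
- by move=> x _; apply: sume_ge0 => i _; have [_ [_ [a0 _]]] := each _ (ltn_ord i); rewrite lee_fin.
- by apply: emeasurable_sum => i; exact: mS.
- move=> x _; rewrite big_filter sumEFin lee_fin; apply: le_trans (cap x).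
  rewrite big_mkcond; apply: ler_sum => i _; have [_ [_ [a0 _]]] := each _ (ltn_ord i).
  by case: ifP.
Qed.

End Feasible.

(** * Integrals of functions restricted to a time window *)

Section Windows.
Local Open Scope classical_set_scope.
Local Open Scope ring_scope.
Variable R : realType.
Notation mu := (@lebesgue_measure R).
Implicit Types (f h H : R -> R).

(** With [H] a primitive of [h], an arbitrary [y] serves both the completion equation and the strict
    inequality before completion. *)
Lemma integral_window f h H (a b e y : R) : measurable_fun setT h ->
  (forall s t, s <= t -> (\int[mu]_(x in `[s, t[) (h x)%:E = (H t - H s)%:E)%E) ->
  (forall x, f x = if b <= x < e then h x else 0) -> a <= b ->
  (\int[mu]_(x in `[a, y]) (f x)%:E =
    (if b <= Num.min y e then H (Num.min y e) - H b else 0)%:E)%E.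
Proof.
move=> mh hH fE ab; have mI : measurable `[b, e[ by exact: measurable_itv.
have fI : (fun x => (f x)%:E) = ((fun x => (h x)%:E) \_ `[b, e[).
  apply/funext => x; rewrite patchE fE mem_setE in_itv/=; by case: ifP.
have mf : measurable_fun `[a, y[ (fun x => (f x)%:E).
  rewrite fI; apply: (measurable_restrict _ mI (measurable_itv _)).1.
  by apply/measurable_EFinP; apply: measurable_funS mh.
rewrite -integral_itv_bndo_bndc// fI -integral_mkcondr.
rewrite (_ : `[a, y[ `&` `[b, e[ = [set` `[b, Num.min y e[]); last first.
  apply/seteqP; split => x; rewrite /= !in_itv/= lt_min.
    by move=> [/andP[_ ->] /andP[-> ->]].
  by move=> /and3P[bx -> ->]; rewrite bx (le_trans ab).
case: leP => [le|lt]; first exact: hH.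
by rewrite set_itv_ge ?integral_set0// -leNgt bnd_simp ltW.
Qed.

End Windows.

(** * Feasibility and competitiveness of the constructed schedule *)

Section OwnSchedule.
Local Open Scope classical_set_scope.
Local Open Scope ring_scope.
Variable R : realType.
Variables (p : nat) (T : TAP R).
Hypothesis p_gt0 : (0 < p)%N.
Hypothesis valid : valid_TAP p T.
Notation mu := (@lebesgue_measure R).

Let w := tsk T.
Let n := size T.
Local Notation a := (fun i => arr (w i)).
Local Notation sg := (fun i => sig (w i)).
Local Notation ch := (ch p w).
Local Notation ser := (fun i => ~~ ch i).
Local Notation start := (start p a sg ser).
Local Notation fin := (fin p a sg ser).
Local Notation spare := (spare p w n).
Local Notation capacity := (capacity p w n).
Local Notation onset := (onset p w n).
Local Notation backlog := (backlog p w n).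
Local Notation instant := (instant p w n).
Local Notation completion := (completion p w n).
Local Notation share := (share p w n).

Lemma valid_arr_le i j : (i <= j < n)%N -> arr (w i) <= arr (w j).
Proof.
move=> /andP[ij jn]; have [_ srt] := valid.
by apply: (sorted_leq_nth _ _ _ srt) => //= [y x z|]; [exact: le_trans|rewrite inE (leq_ltn_trans ij)].
Qed.

Lemma valid_arr_ge0 i : (i < n)%N -> 0 <= arr (w i).
Proof. by move=> /valid.1[]. Qed.

Lemma valid_sig_gt0 i : (i < n)%N -> 0 < sig (w i).
Proof. by move=> /valid.1[_ []]. Qed.

Lemma valid_sig_le_par i : (i < n)%N -> sig (w i) <= par (w i).
Proof. by move=> /valid.1[_ [s0 []]]; rewrite ler_pdivlMr// mul1r. Qed.

Let par_gt0 i : (i < n)%N -> 0 < par (w i).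
Proof. by move=> h; exact: lt_le_trans (valid_sig_gt0 h) (valid_sig_le_par h). Qed.

Let spare0 x : 0 <= spare x.
Proof. exact: spare_ge0. Qed.

Let instantE g x : (x < instant g) = (capacity x < g).
Proof. exact: instant_lt p_gt0 valid_arr_ge0 valid_sig_gt0 g x. Qed.

Let capacityK g : capacity (instant g) = g.
Proof. exact: capacity_instant p_gt0 valid_arr_ge0 valid_sig_gt0 g. Qed.

(** Turns the window of a parallel job on the capacity scale into a window of time. *)
Let opening i : R := Num.max (arr (w i)) (instant (onset i)).

Lemma share_window i x : ch i -> share i x =
  if opening i <= x < completion i then spare x else 0.
Proof.
move=> ci; rewrite /share /completion ci; congr (if _ then _ else _).
have -> : (opening i <= x) = (arr (w i) <= x) && (onset i <= capacity x).
  by rewrite ge_max [instant _ <= x]leNgt instantE -leNgt.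
by rewrite instantE andbA.
Qed.

Lemma capacity_opening i : capacity (opening i) = onset i.
Proof.
rewrite /opening; case: leP => [_|lt]; first exact: capacityK.
apply/eqP; rewrite eq_le; apply/andP; split; first by rewrite le_max lexx.
by rewrite leNgt -instantE -leNgt ltW.
Qed.

Lemma opening_lt i : (i < n)%N -> ch i -> opening i < completion i.
Proof.
move=> lt_in ci; rewrite /completion ci instantE capacity_opening ltrDl.
exact: par_gt0.
Qed.

Lemma share_ge0 i x : 0 <= share i x.
Proof. by rewrite /share; case: ifP => // _; case: ifP. Qed.

Lemma backlog_le i j : (i <= j <= n)%N -> backlog i <= backlog j.
Proof.
move=> /andP[]; elim: j => [|j ih]; first by rewrite leqn0 => /eqP ->.
rewrite leq_eqVlt => /orP[/eqP -> //|ij] jn; apply: (le_trans (ih ij (ltnW jn))) => /=.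
case: ifP => // _; rewrite -[leLHS]addr0 lerD ?(ltW (par_gt0 jn))//.
by rewrite le_max lexx orbT.
Qed.

(** The windows of distinct parallel jobs are disjoint on the capacity scale, so at most one job
    takes [spare x]; serial jobs take the rest. *)
Lemma share_sum x : \sum_(i < n) share i x <= p%:R.
Proof.
rewrite (bigID (fun i : 'I_n => ch i))/=.
have -> : \sum_(i < n | ser i) share i x = (running p a sg ser n x)%:R.
  by rewrite runningE; apply: eq_bigr => i /negbTE si; rewrite /share si.
rewrite -lerBrDr -/(spare x).
have [[i [ci on]]|/forallNP none] := pselect (exists i : 'I_n, ch i /\
    onset i <= capacity x < onset i + par (w i)); last first.
  rewrite big1 ?spare0// => i ci; rewrite /share ci.
  by case: ifP => // /andP[_ h]; case: (none i).
rewrite (bigD1 i)//= big1 ?addr0.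
  by rewrite /share ci; case: ifP.
move=> j /andP[cj ji]; rewrite /share cj; case: ifP => // /andP[_ jon].
have apart k l : (k < l < n)%N -> ch k -> onset k + par (w k) <= onset l.
  move=> /andP[kl ln] ck; apply: (@le_trans _ _ (backlog l)); last by rewrite le_max lexx orbT.
  by apply: le_trans (backlog_le (_ : (k.+1 <= l <= n)%N)); [rewrite /= ck|rewrite kl ltnW].
case: (ltngtP i j) => [ij|lt|/val_inj ij]; last by rewrite ij eqxx in ji.
  have := apart i j; rewrite ij ltn_ord => /(_ isT ci).
  by case/andP: on => _ h1; case/andP: jon => h2 _; rewrite leNgt (le_lt_trans h2).
have := apart j i; rewrite lt ltn_ord => /(_ isT cj).
by case/andP: on => h1 _; case/andP: jon => _ h2; rewrite leNgt (le_lt_trans h1).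
Qed.

Definition own : schedule R := Schedule ch share completion.

(** [H] is [capacity] for a parallel job and [id] for a serial one. Strict growth is claimed only up
    to the completion, the first time its capacity level is reached, since [capacity] may be flat
    elsewhere. *)
Lemma share_integral i y : (i < n)%N ->
  exists (H : R -> R) b, [/\ H (completion i) - H b = work T own i,
    b < completion i,
    (forall s t, s < t -> t = completion i -> H s < H t) &
    (\int[mu]_(x in `[arr (w i), y]) (share i x)%:E =
      (if b <= Num.min y (completion i) then H (Num.min y (completion i)) - H b else 0)%:E)%E].
Proof.
move=> lt_in; rewrite /work /=; case: (boolP (ch i)) => ci.
  exists capacity, (opening i); split.
  - by rewrite /completion ci capacityK capacity_opening addrC addKr.
  - exact: opening_lt.
  - by move=> s t st tC; move: st; rewrite tC /completion ci instantE capacityK.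
  - apply: (@integral_window _ (share i) spare capacity).
    + exact: measurable_spare.
    + by move=> s t st; exact: integral_spare.
    + by move=> x; exact: share_window.
    + by rewrite le_max lexx.
exists id, (start i); rewrite /completion (negbTE ci); split.
- by rewrite /fin addrC addKr.
- by rewrite /fin ltrDl valid_sig_gt0.
- by [].
- apply: (@integral_window _ (share i) (cst 1) id).
  + exact: measurable_cst.
  + move=> s t st; transitivity (\int[mu]_(x in `[s, t[) cst 1%E x)%E => //.
    rewrite integral_cst// mul1e -(len_itv st).
    exact: small_len (small_itv s t).
  + by move=> x; rewrite /share (negbTE ci); case: ifP.
  + exact: start_ge.
Qed.

Lemma own_feasible : feasible p T own.
Proof.
split=> [t|i lt_in]; first exact: share_sum.
have aC : arr (w i) <= completion i.
  apply: completion_ge => //; [exact: valid_arr_ge0|exact: valid_sig_gt0|exact: valid_sig_le_par].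
have win x : share i x != 0 -> arr (w i) <= x < completion i.
  case: (boolP (ch i)) => ci.
    by rewrite share_window//; case: ifP => [/andP[]|_]; rewrite ?eqxx// ge_max => /andP[-> _] ->.
  rewrite /share /completion (negbTE ci); case: (boolP (_ <= x < _)) => [/andP[sx ->]|_].
    by rewrite (le_trans _ sx)// start_ge.
  by rewrite eqxx.
split; [|split; [|split; [|split; [|split; [|split]]]]] => //=.
- case: (boolP (ch i)) => ci; last first.
    by rewrite /Defs.alloc/= /share (negbTE ci); exact: measurable_itvb.
  have -> : share i = spare \* \1_`[opening i, completion i[.
    apply/funext => x; rewrite share_window//= indic_itvE.
    by case: ifP; rewrite ?mulr1 ?mulr0.
  apply: measurable_funM; first exact: measurable_spare.
  exact: measurable_indic.
- by move=> t; exact: share_ge0.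
- move=> t out; apply/eqP/negPn/negP => /win/andP[at_ tC].
  by case: out => h; [rewrite leNgt h in at_|rewrite ltNge (ltW h) in tC].
- move=> ci t; rewrite /share ci; by case: (_ <= t < _).
- have [H [b [HC bC _ ->]]] := share_integral (completion i) lt_in.
  by rewrite minxx (ltW bC) HC.
- move=> t tC; have [H [b [HC bC mono ->]]] := share_integral t lt_in.
  rewrite lte_fin min_l ?(ltW tC)// -HC; case: ifP => _.
    by rewrite ltrD2r; exact: mono.
  by rewrite subr_gt0; exact: mono.
Qed.

Lemma own_competitive (S : schedule R) : feasible p T S ->
  (awake T own <= 3%:E * awake T S)%E.
Proof.
move=> /feasible_profile pr; rewrite !awakeE -EFinM lee_fin.
exact: (total_bound p_gt0 valid_arr_le valid_arr_ge0 valid_sig_gt0 valid_sig_le_par pr).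
Qed.

End OwnSchedule.

(** * Independence from future arrivals *)

Section Online.
Local Open Scope classical_set_scope.
Local Open Scope ring_scope.
Variable R : realType.
Variable p : nat.
Implicit Types (w : nat -> task R) (i j k m n q : nat) (x y t : R).

Lemma alive_ext m K w w' (D : nat -> R) : (forall j, (j < m)%N -> w j = w' j) ->
  alive m K (fun i => arr (w i)) D = alive m K (fun i => arr (w' i)) D.
Proof.
by move=> h; apply/seteqP; split => x [i /andP[im Ki] ix]; exists i; rewrite ?im// ?h// -h.
Qed.

Lemma prefers_par_ext w w' i : (forall j, (j <= i)%N -> w j = w' j) ->
  prefers_par p w i -> prefers_par p w' i.
Proof.
move=> h [c [D [[p1 p2] lt]]]; have h' j : (j < i.+1)%N -> w j = w' j by exact: h.
exists c, D; split; last by rewrite -(alive_ext _ _ h') -h.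
split=> [j ji cj|K]; first by rewrite -h'//; exact: p1.
rewrite -(alive_ext _ _ h'); apply: le_trans _ (p2 K); rewrite le_eqVlt; apply/orP; left.
by apply/eqP; apply: eq_bigr => j _; rewrite /job h'.
Qed.

Lemma ch_ext w w' i : (forall j, (j <= i)%N -> w j = w' j) -> ch p w i = ch p w' i.
Proof.
move=> h; apply/asboolP/asboolP; apply: prefers_par_ext => // j ji.
by rewrite h.
Qed.

Lemma sum_late w n q (F : nat -> R) : (q <= n)%N ->
  (forall j, (q <= j < n)%N -> F j = 0) ->
  \sum_(j < n | ~~ ch p w j) F j = \sum_(j < q | ~~ ch p w j) F j.
Proof.
move=> qn F0; rewrite [RHS](big_ord_widen_cond n (fun j => ~~ ch p w j) F)//.
rewrite big_mkcond [RHS]big_mkcond; apply: eq_bigr => j _; case: ifP => //= _.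
by case: ltnP => // qj; rewrite F0// qj ltn_ord.
Qed.

Lemma capacity_late w n q x y : (q <= n)%N ->
  (forall j, (q <= j < n)%N -> x < arr (w j)) -> y <= x ->
  capacity p w n y = capacity p w q y.
Proof.
move=> qn late yx; rewrite /capacity (sum_late _ (F := fun j => exec _ _ _ _ j y) qn)// => j qj.
apply: exec_early; apply: (le_trans yx); apply: (le_trans (ltW (late _ qj))).
exact: (start_ge p (fun i => arr (w i))).
Qed.

Lemma spare_late w n q x : (q <= n)%N ->
  (forall j, (q <= j < n)%N -> x < arr (w j)) -> spare p w n x = spare p w q x.
Proof.
move=> qn late; rewrite /spare !runningE.
rewrite (sum_late _ (F := fun j => (start _ _ _ _ j <= x < fin _ _ _ _ j)%R%:R) qn)// => j qj.
have := start_ge p (fun i => arr (w i)) (fun i => sig (w i)) (fun i => ~~ ch p w i) j.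
by move/(lt_le_trans (late _ qj)); rewrite leNgt => ->.
Qed.

Lemma backlog_late w n q x i : (q <= n)%N ->
  (forall j, (q <= j < n)%N -> x < arr (w j)) ->
  (forall j, (j < q)%N -> arr (w j) <= x) -> (i <= q)%N ->
  backlog p w n i = backlog p w q i.
Proof.
move=> qn late early; elim: i => //= i ih iq.
by rewrite ih ?(ltnW iq)// (capacity_late qn late (early _ iq)).
Qed.

(** Serial jobs start no earlier than they arrive, so tasks arriving after [x] affect neither
    [capacity] up to [x] nor [spare x]. *)
Lemma share_late w n q x i : (q <= n)%N ->
  (forall j, (q <= j < n)%N -> x < arr (w j)) ->
  (forall j, (j < q)%N -> arr (w j) <= x) -> (i < q)%N ->
  share p w n i x = share p w q i x.
Proof.
move=> qn late early iq; rewrite /share /onset (backlog_late qn late early (ltnW iq)).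
by rewrite (capacity_late qn late (early _ iq)) (capacity_late qn late (lexx x)) (spare_late qn late).
Qed.

Section SameTasks.
Variables (w w' : nat -> task R) (q : nat).
Hypothesis same : forall j, (j < q)%N -> w j = w' j.

Let same_list i : (i < q)%N ->
  [/\ arr (w i) = arr (w' i), sig (w i) = sig (w' i) & ~~ ch p w i = ~~ ch p w' i].
Proof.
move=> iq; rewrite same//; split => //; congr (~~ _); apply: ch_ext => j ji.
by apply: same; exact: leq_ltn_trans iq.
Qed.

Let same_ch i : (i < q)%N -> ch p w i = ch p w' i.
Proof. by move=> /same_list[_ _ /negb_inj]. Qed.

Lemma same_capacity y : capacity p w q y = capacity p w' q y.
Proof.
rewrite /capacity; congr (_ - _); rewrite big_mkcond [RHS]big_mkcond.
apply: eq_bigr => j _; rewrite same_ch//; case: ifP => // _.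
by rewrite /exec (start_ext p same_list)// (fin_ext p same_list).
Qed.

Lemma same_spare y : spare p w q y = spare p w' q y.
Proof.
rewrite /spare !runningE; congr (_ - _); rewrite big_mkcond [RHS]big_mkcond.
apply: eq_bigr => j _; rewrite same_ch//; case: ifP => // _.
by rewrite (start_ext p same_list)// (fin_ext p same_list).
Qed.

Lemma same_backlog i : (i <= q)%N -> backlog p w q i = backlog p w' q i.
Proof.
elim: i => //= i ih iq.
by rewrite ih ?(ltnW iq)// same_ch// same_capacity same.
Qed.

Lemma same_share i x : (i < q)%N -> share p w q i x = share p w' q i x.
Proof.
move=> iq; have on : onset p w q i = onset p w' q i.
  by rewrite /onset same_capacity (same_backlog (ltnW iq)) (same iq).
have st := start_ext p same_list iq; have fi := fin_ext p same_list iq.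
by rewrite /share (same_ch iq) on same_capacity same_spare st fi (same iq).
Qed.

End SameTasks.

(** Sortedness makes the filter an initial segment, so indices in the prefix are indices in [T]. *)
Lemma prefix_take t (T : TAP R) : sorted (fun x y : task R => arr x <= arr y) T ->
  exists q, [/\ (q <= size T)%N, Defs.prefix t T = take q T,
    (forall j, (j < q)%N -> arr (tsk T j) <= t) &
    (forall j, (q <= j < size T)%N -> t < arr (tsk T j))].
Proof.
elim: T => [_|x s ih]; first by exists 0%N.
rewrite /= path_sortedE; last by move=> y u v; exact: le_trans.
move=> /andP[/(all_nthP (task0 R)) xs /ih[q [qs pq early late]]].
rewrite /Defs.prefix /=; case: ifPn => [xt|]; last first.
  rewrite -ltNge => tx; exists 0%N; split => //.
    apply: size0nil; apply/eqP; rewrite size_filter -leqn0 leqNgt -has_count -all_predC.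
    by apply/(all_nthP (task0 R)) => j /xs /(lt_le_trans tx); rewrite /= -ltNge.
  by move=> [|j] //=; rewrite ltnS => /xs; exact: lt_le_trans.
exists q.+1; split => //=; first by rewrite -/(Defs.prefix t s) pq.
  by move=> [|j] //=; rewrite ltnS; exact: early.
by move=> [|j] //=; rewrite !ltnS; exact: late.
Qed.

Lemma prefix_same t (T T' : TAP R) : valid_TAP p T -> valid_TAP p T' ->
  Defs.prefix t T = Defs.prefix t T' -> exists q,
  [/\ q = size (Defs.prefix t T), (q <= size T)%N, (q <= size T')%N &
   [/\ forall j, (j < q)%N -> tsk T j = tsk T' j,
    forall j, (j < q)%N -> arr (tsk T j) <= t,
    forall j, (q <= j < size T)%N -> t < arr (tsk T j) &
    forall j, (q <= j < size T')%N -> t < arr (tsk T' j)]].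
Proof.
move=> [_ /(prefix_take t)[q [qT pq early late]]] [_ /(prefix_take t)[q' [qT' pq' _ late']]] e.
have qq : q = q' by rewrite -(size_takel qT) -pq e pq' size_takel.
subst q'; exists q; split; rewrite ?pq ?size_takel//; split => // j jq.
by rewrite /tsk -(nth_take _ jq) -pq e pq' nth_take.
Qed.

Lemma own_online : online p (@own R p).
Proof.
move=> T T' t vT vT' e i.
have [q [<- qT qT' [same early late late']]] := prefix_same vT vT' e => iq /=.
rewrite (share_late qT late early iq) (share_late qT' late' _ iq).
  exact: same_share.
by move=> j jq; rewrite -same// early.
Qed.

Lemma own_decides : decide_on_arrival p (@own R p).
Proof.
move=> T T' i vT vT' iT e /=; set t := arr (tsk T i) in e.
have [q [_ qT qT' [same _ late _]]] := prefix_same vT vT' e.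
apply: ch_ext => j ji; apply: same; apply: leq_ltn_trans ji _.
by rewrite ltnNge; apply/negP => qi; have := late i; rewrite qi iT ltxx => /(_ isT).
Qed.

End Online.

Theorem theorem4p2 :
  exists p0 : nat, forall (R : realType) (p : nat), (p0 <= p)%N ->
    exists A : scheduler R,
      online p A /\ decide_on_arrival p A /\
      forall T : TAP R, valid_TAP p T ->
        feasible p T (A T) /\
        forall S : schedule R, feasible p T S ->
          (awake T (A T) <= 3%:E * awake T S)%E.
Proof.
(* Dividing by [p] and taking the [p]-th largest completion time both ask for a positive [p]. *)
exists 1%N => R p p_gt0; exists (@own R p).
split; first exact: own_online.
split=> [|T valid]; first exact: own_decides.
by split=> [|S]; [exact: own_feasible|exact: own_competitive].
Qed.
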